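(* Let $G=(V,\mathcal E,w)$ be an undirected, connected, weighted graph on $n$ nodes with Laplacian $L=\sum_{e\in\mathcal E}w(e)E_eE_e^T$ and largest Laplacian eigenvalue $\lambda_n$. Let $\tau\ge0$ with $\tau\lambda_n<\pi/2$. Consider the consensus network with dynamics noise $$\dot x(t)=-L\,x(t-\tau)+\xi(t),\qquad y=M_nx,$$ where $\xi$ is a vector of $n$ mutually independent zero-mean Gaussian white noises of unit intensity. Then for every link $e=\{i,j\}\in\mathcal E$ the sensitivity coefficient is $$\kappa_e=\frac12\,E_e^{T}\,(L^2)^{\dagger}\big(\tau L-\cos(\tau L)\big)\big(M_n-\sin(\tau L)\big)^{\dagger}\,E_e .$$
   Context: Notation: - $E_e=e_i-e_j\in\mathbb R^n$, for an arbitrary orientation. - $M_n=I_n-\frac1n\mathbf1\mathbf1^T$. - $X^\dagger$ is the Moore–Penrose pseudo-inverse. - $\cos(X)$ and $\sin(X)$ are the matrix power-series functions. The performance is $$\rho_{ss}(L;\tau)=\lim_{t\to\infty}\mathbb E[y^Ty]=\frac1{2\pi}\int_{-\infty}^\infty\mathrm{Tr}[G(j\omega)^HG(j\omega)]d\omega,\qquad G(s)=M_n(sI+e^{-\tau s}L)^{-1}.$$ The sensitivity coefficient of link $e$ is $\kappa_e=\partial\rho_{ss}/\partial w(e)$, the derivative of the performance with respect to the weight of $e$. *)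

(* Defs.v *)
From HB Require Import structures.
From mathcomp Require Import all_boot all_order all_algebra.
From mathcomp Require Import all_classical all_reals all_analysis.
From mathcomp Require complex.
Import complex.ComplexField.

Set Implicit Arguments.
Unset Strict Implicit.
Unset Printing Implicit Defensive.

Import Order.TTheory GRing.Theory Num.Theory.
Local Open Scope ring_scope.
Local Open Scope classical_set_scope.

Section Defs.
Variable R : realType.
Variable n : nat.

Definition Evec (i j : 'I_n) : 'cV[R]_n :=
  \col_k ((k == i)%:R - (k == j)%:R).

Definition weighted_graph (adj : rel 'I_n) (w : 'I_n -> 'I_n -> R) : Prop :=
  (forall i j, adj i j = adj j i) /\ (forall i, ~~ adj i i) /\
  (forall i j, w i j = w j i) /\ (forall i j, adj i j -> 0 < w i j).

Definition connected_graph (adj : rel 'I_n) : Prop :=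
  forall i j, connect adj i j.

Definition laplacian (adj : rel 'I_n) (w : 'I_n -> 'I_n -> R) : 'M[R]_n :=
  \sum_(i : 'I_n) \sum_(j : 'I_n | (i < j)%N && adj i j)
     w i j *: (Evec i j *m (Evec i j)^T).

Definition wupd (w : 'I_n -> 'I_n -> R) (a b : 'I_n) (t : R) :=
  fun i j => if ((i == a) && (j == b)) || ((i == b) && (j == a))
             then w i j + t else w i j.

Definition lambda_max (A : 'M[R]_n) : R :=
  xget 0 [set l | eigenvalue A l /\ forall mu, eigenvalue A mu -> mu <= l].

Definition Mn : 'M[R]_n := 1%:M - n%:R^-1 *: const_mx 1.

Definition penrose (A X : 'M[R]_n) : Prop :=
  [/\ A *m X *m A = A, X *m A *m X = X,
      (A *m X)^T = A *m X & (X *m A)^T = X *m A].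
Definition mpinv (A : 'M[R]_n) : 'M[R]_n := xget 0 [set X | penrose A X].

Definition cosmx (X : 'M[R]_n) : 'M[R]_n :=
  \matrix_(i, j) limn (fun N : nat =>
    (\sum_(k < N) ((-1) ^+ k / (k.*2)`!%:R) *: X ^+ k.*2) i j).
Definition sinmx (X : 'M[R]_n) : 'M[R]_n :=
  \matrix_(i, j) limn (fun N : nat =>
    (\sum_(k < N) ((-1) ^+ k / (k.*2.+1)`!%:R) *: X ^+ k.*2.+1) i j).

(* G(j omega) = M_n (j omega I + e^{-j omega tau} L)^{-1}, complex matrix *)
Definition Cmx (A : 'M[R]_n) : 'M[complex.complex R]_n :=
  map_mx (fun r => complex.Complex r 0) A.
Definition Gtf (L : 'M[R]_n) (tau omega : R) : 'M[complex.complex R]_n :=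
  Cmx Mn *m invmx (complex.Complex 0 omega *: 1%:M
    + complex.Complex (cos (omega * tau)) (- sin (omega * tau)) *: Cmx L).

(* Tr[G^H G] (a real number) *)
Definition trGHG (L : 'M[R]_n) (tau omega : R) : R :=
  complex.Re (\tr ((map_mx (@complex.conjc R) (Gtf L tau omega))^T
                    *m Gtf L tau omega)).

Definition rho_ss (L : 'M[R]_n) (tau : R) : R :=
  (2 * pi)^-1 * Rintegral lebesgue_measure setT (trGHG L tau).

End Defs.

(* Main.v *)
Require Import Defs.
From HB Require Import structures.
From mathcomp Require Import all_boot all_order all_algebra.
From mathcomp Require Import all_classical all_reals all_analysis.
From mathcomp Require Import measurable_realfun ring lra.
From mathcomp Require Import complex spectral sesquilinear.
Import Order.TTheory GRing.Theory Num.Theory.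
Import ComplexField ComplexField.Normc numFieldNormedType.Exports.
Local Open Scope ring_scope.
Local Open Scope classical_set_scope.

Set Implicit Arguments.
Unset Strict Implicit.
Unset Printing Implicit Defensive.

(** Diagonalising [L = U diag(d) U^T] turns [rho_ss] into the sum over the modes
    [l = d k] of [(2 pi)^-1] times the integral over [x] of
    [1 / |j x + l exp(- j tau x)|^2], and [f l = cos (tau l) / (2 l (1 - sin (tau l)))]
    is the value of each term.  After rescaling to [l = 1], [s = tau l], this
    amounts to
      [integral of 1 / |D(j x)|^2 = C pi], [D z = z + exp(- s z)],
      [C = cos s / (1 - sin s)].
    With the Cayley transforms [W = (exp(- s z) - z) / D z] and
    [W0 = (1 - z) / (1 + z)], the function [K = (W - C W0) / (1 + z^2)] is
    holomorphic and O(1/|z|^2) on the closed right half-plane: [C] is exactly what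
    removes the poles at [z = j] and [z = - j].  Hence the integral of [K] along
    vertical lines does not depend on the line and vanishes, while
    [Re (K (j x)) = 1 / |D(j x)|^2 - C / (1 + x^2)].

    For the derivative, let [L + t E E^T = V diag(m) V^T] and
    [c k l = <u_k, v_l>]; then [c k l * (m l - d k) = t <u_k, E> <v_l, E>], whence
      [sum f(m l) - sum f(d k) - t sum f'(d k) <u_k, E>^2
         = sum (c k l)^2 (f(m l) - f(d k) - f'(d k) (m l - d k))]
    and the right-hand side is o(t): differentiability of [f] at the [d k] and
    boundedness of [f] near the spectrum suffice, no perturbation theory of
    eigenvectors is needed. *)

Local Notation Complex := complex.Complex.
Local Notation Re := complex.Re.
Local Notation Im := complex.Im.

(** * Complex-valued functions of a real variable *)

Section PointwiseDerive.
Variable R : realType.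
Implicit Types (f g : R -> R) (x a b : R).

Lemma derive_add f g x a b : is_derive x 1 f a -> is_derive x 1 g b ->
  is_derive x 1 (fun u => f u + g u) (a + b).
Proof. by move=> *; exact: is_deriveD. Qed.

Lemma derive_opp f x a : is_derive x 1 f a -> is_derive x 1 (fun u => - f u) (- a).
Proof. by move=> *; exact: is_deriveN. Qed.

Lemma derive_sub f g x a b : is_derive x 1 f a -> is_derive x 1 g b ->
  is_derive x 1 (fun u => f u - g u) (a - b).
Proof. by move=> fa gb; apply: derive_add => //; exact: derive_opp. Qed.

Lemma derive_mul f g x a b : is_derive x 1 f a -> is_derive x 1 g b ->
  is_derive x 1 (fun u => f u * g u) (a * g x + f x * b).
Proof.
move=> fa gb; apply: (is_derive_eq (is_deriveM fa gb)).
by rewrite /GRing.scale/= addrC [g x * _]mulrC.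
Qed.

Lemma derive_inv f x a : f x != 0 -> is_derive x 1 f a ->
  is_derive x 1 (fun u => (f u)^-1) (- a / f x ^+ 2).
Proof.
move=> fx0 fa; apply: (is_derive_eq (is_deriveV fx0 fa)).
by rewrite /GRing.scale/= !mulNr mulrC.
Qed.

End PointwiseDerive.

Section ComplexCalculus.
Variable R : realType.
Implicit Types (f g : R -> R[i]) (t : R) (z : R[i]).

(** Differentiation in a real parameter only. Holomorphy enters through chain rules with derivative
    F' (f t) * z', used along horizontal and vertical lines alike; the Cauchy-Riemann equations are
    contained in this. *)
Definition cderive f t z :=
  is_derive t 1 (fun u => Re (f u)) (Re z) /\
  is_derive t 1 (fun u => Im (f u)) (Im z).

Lemma cderive_eq f t z z' : cderive f t z -> z = z' -> cderive f t z'.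
Proof. by move=> ? <-. Qed.

Lemma cderive_ext f g t z : f =1 g -> cderive f t z -> cderive g t z.
Proof. by move=> /funext ->. Qed.

Lemma cderive_cst t z : cderive (fun=> z) t 0.
Proof. by split; exact: is_derive_cst. Qed.

Lemma Re_add z z' : Re (z + z') = Re z + Re z'. Proof. by case: z; case: z'. Qed.
Lemma Im_add z z' : Im (z + z') = Im z + Im z'. Proof. by case: z; case: z'. Qed.
Lemma Re_opp z : Re (- z) = - Re z. Proof. by case: z. Qed.
Lemma Im_opp z : Im (- z) = - Im z. Proof. by case: z. Qed.
Lemma Re_mul z z' : Re (z * z') = Re z * Re z' - Im z * Im z'.
Proof. by case: z; case: z'. Qed.
Lemma Im_mul z z' : Im (z * z') = Re z * Im z' + Im z * Re z'.
Proof. by case: z; case: z'. Qed.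
Lemma Re_inv z : Re z^-1 = Re z / (Re z ^+ 2 + Im z ^+ 2).
Proof. by case: z. Qed.
Lemma Im_inv z : Im z^-1 = - (Im z / (Re z ^+ 2 + Im z ^+ 2)).
Proof. by case: z. Qed.
Definition ReImE := (Re_add, Im_add, Re_opp, Im_opp, Re_mul, Im_mul).

Lemma complex_eqP z z' : Re z = Re z' -> Im z = Im z' -> z = z'.
Proof. by case: z => a b; case: z' => c d /= -> ->. Qed.

Lemma sqr_ReIm_neq0 z : z != 0 -> Re z ^+ 2 + Im z ^+ 2 != 0.
Proof.
apply: contra_neq => /eqP; rewrite paddr_eq0 ?sqr_ge0 // !sqrf_eq0.
by case/andP=> /eqP ? /eqP ?; apply: complex_eqP.
Qed.

Lemma cderiveD f g t z z' : cderive f t z -> cderive g t z' ->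
  cderive (fun u => f u + g u) t (z + z').
Proof.
move=> [f1 f2] [g1 g2]; split; rewrite ReImE.
- by under eq_fun do rewrite ReImE; exact: is_deriveD.
- by under eq_fun do rewrite ReImE; exact: is_deriveD.
Qed.

Lemma cderiveN f t z : cderive f t z -> cderive (fun u => - f u) t (- z).
Proof.
move=> [f1 f2]; split; rewrite ReImE.
- by under eq_fun do rewrite ReImE; exact: is_deriveN.
- by under eq_fun do rewrite ReImE; exact: is_deriveN.
Qed.

Lemma cderiveM f g t z z' : cderive f t z -> cderive g t z' ->
  cderive (fun u => f u * g u) t (z * g t + f t * z').
Proof.
move=> [f1 f2] [g1 g2]; split; rewrite !ReImE.
- under eq_fun do rewrite ReImE.
  apply: (is_derive_eq (derive_sub (derive_mul f1 g1) (derive_mul f2 g2))).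
  by rewrite /=; ring.
- under eq_fun do rewrite ReImE.
  apply: (is_derive_eq (derive_add (derive_mul f1 g2) (derive_mul f2 g1))).
  by rewrite /=; ring.
Qed.

Lemma cderiveV f t z : f t != 0 -> cderive f t z ->
  cderive (fun u => (f u)^-1) t (- z / f t ^+ 2).
Proof.
move=> ft0 [f1 f2]; have n0 := sqr_ReIm_neq0 ft0.
pose n u := Re (f u) * Re (f u) + Im (f u) * Im (f u).
have nE u : Re (f u) ^+ 2 + Im (f u) ^+ 2 = n u by rewrite /n; ring.
have dn : is_derive t 1 n
    (Re z * Re (f t) + Re (f t) * Re z + (Im z * Im (f t) + Im (f t) * Im z)).
  by apply: derive_add; apply: derive_mul.
rewrite nE in n0.
have := derive_inv n0 dn; set d := (X in is_derive _ _ _ X) => dV.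
have n1 : Re (f t ^+ 2) ^+ 2 + Im (f t ^+ 2) ^+ 2 = n t ^+ 2.
  by rewrite expr2 !ReImE /n; ring.
split.
- under eq_fun do rewrite Re_inv nE.
  apply: (is_derive_eq (derive_mul f1 dV)).
  rewrite !ReImE Re_inv Im_inv n1 /d expr2 !ReImE -/(n t).
  by move: n0; rewrite /n => n0; field; rewrite n0.
- under eq_fun do rewrite Im_inv nE.
  apply: (is_derive_eq (derive_opp (derive_mul f2 dV))).
  rewrite !ReImE Re_inv Im_inv n1 /d expr2 !ReImE -/(n t).
  by move: n0; rewrite /n => n0; field; rewrite n0.
Qed.

Definition cexp z := Complex (expR (Re z) * cos (Im z)) (expR (Re z) * sin (Im z)).

Lemma cderive_cexp f t z : cderive f t z ->
  cderive (fun u => cexp (f u)) t (cexp (f t) * z).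
Proof.
move=> [f1 f2].
have de : is_derive t 1 (fun u => expR (Re (f u))) (expR (Re (f t)) * Re z).
  apply: (is_derive_eq (@is_derive1_comp _ expR _ t _ _ (is_derive_expR _) f1)).
  by rewrite mulrC.
have dc : is_derive t 1 (fun u => cos (Im (f u))) (- sin (Im (f t)) * Im z).
  by apply: (is_derive_eq (@is_derive1_comp _ cos _ t _ _ (is_derive_cos _) f2)).
have ds : is_derive t 1 (fun u => sin (Im (f u))) (cos (Im (f t)) * Im z).
  by apply: (is_derive_eq (@is_derive1_comp _ sin _ t _ _ (is_derive_sin _) f2)).
split; rewrite ReImE /=.
- by apply: (is_derive_eq (derive_mul de dc)) => /=; ring.
- by apply: (is_derive_eq (derive_mul de ds)) => /=; ring.
Qed.

Lemma ccontinuous_Re f t z : cderive f t z -> {for t, continuous (fun u => Re (f u))}.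
Proof. by move=> [[fd _] _]; exact/differentiable_continuous/derivable1_diffP. Qed.

Lemma normc_ge0 z : 0 <= normc z. Proof. by case: z => a b; exact: sqrtr_ge0. Qed.

Lemma normc_gt0 z : (0 < normc z) = (z != 0).
Proof.
rewrite lt_neqAle normc_ge0 andbT eq_sym; apply/idP/idP; apply: contra_neq.
  by move=> ->; exact: normc0.
exact: eq0_normc.
Qed.

Lemma normcD z z' : normc (z + z') <= normc z + normc z'.
Proof. exact: complex.le_normcD. Qed.

Lemma normc_opp z : normc (- z) = normc z.
Proof. exact: complex.normcN. Qed.

Lemma normcB z z' : normc (z - z') <= normc z + normc z'.
Proof. by rewrite -(normc_opp z') normcD. Qed.

Lemma sqr_normc z : normc z ^+ 2 = Re z ^+ 2 + Im z ^+ 2.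
Proof. by case: z => a b; rewrite /normc sqr_sqrtr // addr_ge0 ?sqr_ge0. Qed.

Lemma normc_Re z : `|Re z| <= normc z.
Proof.
rewrite -(ger0_norm (normc_ge0 z)) -ler_sqr ?nnegrE // ?normr_ge0 //.
by rewrite !real_normK ?num_real // sqr_normc lerDl sqr_ge0.
Qed.

Lemma normc_Im z : `|Im z| <= normc z.
Proof.
rewrite -(ger0_norm (normc_ge0 z)) -ler_sqr ?nnegrE // ?normr_ge0 //.
by rewrite !real_normK ?num_real // sqr_normc lerDr sqr_ge0.
Qed.

Lemma normc_le z : normc z <= `|Re z| + `|Im z|.
Proof.
rewrite -ler_sqr ?nnegrE ?addr_ge0 ?normc_ge0 ?normr_ge0 //.
rewrite sqr_normc sqrrD !real_normK ?num_real // addrAC lerDl.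
by rewrite mulrn_wge0 // mulr_ge0.
Qed.

Lemma normcX z k : normc (z ^+ k) = normc z ^+ k.
Proof. by elim: k => [|k IH]; rewrite ?normc1 // !exprS normcM IH. Qed.

Lemma normc_cexp z : normc (cexp z) = expR (Re z).
Proof.
apply/eqP; rewrite -(eqrXn2 (n := 2)) ?normc_ge0 ?expR_ge0 // sqr_normc /=.
by rewrite !exprMn -mulrDr cos2Dsin2 mulr1.
Qed.

End ComplexCalculus.

(** * The frequency integral *)

Section DelayKernel.
Variables (R : realType) (s : R).
Hypotheses (s_ge0 : 0 <= s) (s_lt : s < pi / 2).
Implicit Types z : R[i].

Let i : R[i] := Complex 0 1.
Let rc (x : R) : R[i] := Complex x 0.

Definition delay_exp z := cexp (- (rc s * z)).
Definition delay_den z := z + delay_exp z.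
Definition delay_gain := cos s / (1 - sin s).
(* These are the Cayley transforms [(exp(- s z) - z) / (exp(- s z) + z)] and
   [(1 - z) / (1 + z)]. *)
Definition cayley z := 2 * delay_exp z / delay_den z - 1.
Definition cayley0 z := 2 / (1 + z) - 1.
Definition kernel_num z := cayley z - rc delay_gain * cayley0 z.
Definition delay_kernel z := kernel_num z / (1 + z ^+ 2).
(** The complex derivatives of [cayley], [kernel_num] and [delay_kernel] in closed form. In
    [dcayley] the two terms in s exp(- 2 s z) have cancelled. *)
Definition dcayley z :=
  - (2 * delay_exp z * (1 + rc s * z)) / delay_den z ^+ 2.
Definition dkernel_num z :=
  dcayley z + rc delay_gain * (2 / (1 + z) ^+ 2).
Definition ddelay_kernel z := dkernel_num z / (1 + z ^+ 2)
  - 2 * z * kernel_num z / (1 + z ^+ 2) ^+ 2.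

(** * Bounds on the denominator and on the kernel in the right half-plane *)

Lemma cos_delay_gt0 : 0 < cos s.
Proof.
apply: cos_gt0_pihalf; rewrite s_lt andbT (lt_le_trans _ s_ge0) // oppr_lt0.
by rewrite divr_gt0 ?pi_gt0.
Qed.

Lemma sin_delay_lt1 : sin s < 1.
Proof.
rewrite lt_neqAle sin_le1 andbT; apply/eqP => ss.
have := cos2Dsin2 s; have := cos_delay_gt0; rewrite ss; nra.
Qed.

Lemma delay_expE z : delay_exp z =
  Complex (expR (- (s * Re z)) * cos (s * Im z))
          (- (expR (- (s * Re z)) * sin (s * Im z))).
Proof.
apply: complex_eqP; rewrite /delay_exp /cexp !ReImE /= !mul0r subr0 addr0.
  by rewrite cosN.
by rewrite sinN mulrN.
Qed.

Lemma normc_delay_exp z : 0 <= Re z -> normc (delay_exp z) <= 1.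
Proof.
move=> z0; rewrite normc_cexp !ReImE /= mul0r subr0 -expR0 ler_expR.
by rewrite oppr_le0 mulr_ge0.
Qed.

(* For [|Im z| <= 1 + eta] the real part is bounded below since
   [s (1 + eta) < pi / 2]; otherwise [|Im z|] exceeds [|exp(- s z)| <= 1] by [eta]. *)
Lemma delay_den_lb : exists2 d : R, 0 < d & forall z, 0 <= Re z ->
  d <= normc (delay_den z).
Proof.
have [p hp] : {p : R | p = pi / 2} by exists (pi / 2).
have p0 : 0 < p by rewrite hp divr_gt0 ?pi_gt0.
have s_ltp : s < p by rewrite hp.
pose eta : R := (p - s) / 2.
have eta0 : 0 < eta by rewrite /eta divr_gt0 // subr_gt0.
(* Since s < p < 2, the difference p - s (1 + eta) = (p - s) (1 - s / 2) is positive. *)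
have pi2 : p < 2 by rewrite hp pihalf_lt2.
have h1 : s * (1 + eta) < p.
  have : 0 <= s * (2 - s) by apply: mulr_ge0 => //; lra.
  by rewrite /eta; nra.
have h2 : 0 <= s * (1 + eta) by apply: mulr_ge0 => //; lra.
have g0 : 0 < cos (s * (1 + eta)) by apply: cos_gt0_pihalf; rewrite -hp; apply/andP; split; lra.
set g := cos _ in g0.
exists (Num.min (g / 2) (Num.min 4^-1 eta)).
  by rewrite !lt_min divr_gt0 //= eta0 invr_gt0 ltr0n.
move=> z z0.
have E : expR (- (s * Re z)) <= 1.
  by rewrite -expR0 ler_expR oppr_le0 mulr_ge0.
have E0 : 0 <= expR (- (s * Re z)) by exact: expR_ge0.
have [x1|x1] := lerP `|Im z| (1 + eta); last first.
  apply: (@le_trans _ _ eta); first by rewrite !ge_min lexx !orbT.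
  apply: (le_trans _ (normc_Im _)).
  rewrite /delay_den delay_expE Im_add /=.
  apply: (le_trans _ (lerB_dist _ _)).
  have : `|expR (- (s * Re z)) * sin (s * Im z)| <= 1.
    by rewrite normrM ger0_norm // mulr_ile1 // sin_max.
  lra.
apply: (le_trans _ (normc_Re _)).
rewrite /delay_den delay_expE Re_add /=.
apply: (le_trans _ (ler_norm _)).
have gc : g <= cos (s * Im z).
  rewrite -(cos_norm (s * _)) normrM (ger0_norm s_ge0) /g.
  have pp : pi = 2 * p :> R by rewrite hp; field.
  have h3 : s * `|Im z| <= s * (1 + eta) by rewrite ler_wpM2l.
  have h4 : 0 <= s * `|Im z| by rewrite mulr_ge0.
  rewrite leNgt ltr_cos -?leNgt // in_itv/= pp; apply/andP; split => //; lra.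
have E1 : 1 - s * Re z <= expR (- (s * Re z)) by exact: expR_ge1Dx.
have Eg : expR (- (s * Re z)) * g <= expR (- (s * Re z)) * cos (s * Im z).
  by rewrite ler_wpM2l.
(* The real part is at least Re z + g exp(- s Re z). For Re z <= 1/4 the exponential is at least 1 -
   s / 4 >= 1/2; otherwise Re z alone exceeds 1/4. *)
have [a1|a1] := lerP (Re z) 4^-1.
  apply: (@le_trans _ _ (g / 2)); first by rewrite ge_min lexx.
  have : 2^-1 * g <= expR (- (s * Re z)) * g.
    apply: ler_wpM2r; [exact: ltW|apply: (le_trans _ E1)].
    have : s * Re z <= 2 * 4^-1 by rewrite ler_pM //; lra.
    lra.
  lra.
apply: (@le_trans _ _ 4^-1); first by rewrite !ge_min lexx !orbT.
have : 0 <= expR (- (s * Re z)) * g by rewrite mulr_ge0 // ltW.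
lra.
Qed.

Lemma delay_den_neq0 z : 0 <= Re z -> delay_den z != 0.
Proof.
move=> z0; have [d d0 h] := delay_den_lb.
by rewrite -normc_gt0 (lt_le_trans d0) // h.
Qed.

Lemma normc_oneD_ge1 z : 0 <= Re z -> 1 <= normc (1 + z).
Proof.
move=> z0; apply: (le_trans _ (normc_Re _)); rewrite Re_add /=.
by rewrite ger0_norm ?addr_ge0 // lerDl.
Qed.

Lemma oneD_neq0 z : 0 <= Re z -> 1 + z != 0.
Proof. by move=> z0; rewrite -normc_gt0 (lt_le_trans ltr01) ?normc_oneD_ge1. Qed.

Lemma oneD_sqr_factor z : 1 + z ^+ 2 = (z - i) * (z + i).
Proof.
have ii : i * i = -1 by apply: complex_eqP; rewrite ReImE /=; ring.
by rewrite mulrBl !mulrDr ii -expr2 [i * z]mulrC; ring.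
Qed.

(** Valid up to the imaginary axis except at [i] and [- i]; this later gives convergence of the
    kernel when a vertical line is pushed onto that axis. *)
Lemma cderive_delay_kernel (f : R -> R[i]) (t : R) z' : 0 <= Re (f t) -> 1 + f t ^+ 2 != 0 ->
  cderive f t z' ->
  cderive (fun u => delay_kernel (f u)) t (ddelay_kernel (f t) * z').
Proof.
move=> ft0 ft1 df.
have D0 := delay_den_neq0 ft0; have O0 := oneD_neq0 ft0.
have de : cderive (fun u => delay_exp (f u)) t (- rc s * delay_exp (f t) * z').
  apply: (cderive_eq (cderive_cexp (cderiveN (cderiveM (cderive_cst _ _) df)))).
  by rewrite /delay_exp; ring.
have dd := cderiveD df de.
have dW := cderiveD (cderiveM (cderiveM (cderive_cst t 2) de) (cderiveV D0 dd))
   (cderive_cst t (-1)).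
have dW0 := cderiveD (cderiveM (cderive_cst t 2)
   (cderiveV O0 (cderiveD (cderive_cst t 1) df))) (cderive_cst t (-1)).
have dnum := cderiveD dW (cderiveN (cderiveM (cderive_cst t (rc delay_gain)) dW0)).
have dsq := cderiveD (cderive_cst t 1) (cderiveM df df).
have ft1' : 1 + f t * f t != 0 by rewrite -expr2.
apply: (cderive_eq (cderiveM dnum (cderiveV ft1' dsq))).
rewrite /ddelay_kernel /dkernel_num /kernel_num /dcayley /cayley /cayley0.
move: D0; rewrite /delay_den => D0.
by field; apply/and3P; split.
Qed.

Lemma normc_rc (x : R) : normc (rc x) = `|x|.
Proof. by rewrite /normc /= expr0n /= addr0 sqrtr_sqr. Qed.

Lemma normc_nat2 : normc (2 : R[i]) = 2.
Proof.
have -> : (2 : R[i]) = rc 2 by apply: complex_eqP; rewrite /= ?addr0.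
by rewrite normc_rc ger0_norm.
Qed.

Lemma normc_i : normc i = 1.
Proof. by rewrite /normc /= expr0n /= expr1n add0r sqrtr1. Qed.

Lemma delay_gain_ge0 : 0 <= delay_gain.
Proof. by rewrite divr_ge0 // ?subr_ge0 ?sin_le1 // ltW // cos_delay_gt0. Qed.

Lemma cayley0_le z : 0 <= Re z -> normc (cayley0 z) <= 3.
Proof.
move=> z0; apply: (le_trans (normcB _ _)); rewrite normc1 normcM normcV normc_nat2.
have : 2 / normc (1 + z) <= 2.
  by rewrite ler_pdivrMr ?(lt_le_trans ltr01) ?normc_oneD_ge1 // ler_peMr // normc_oneD_ge1.
lra.
Qed.

Lemma kernel_num_bounded : exists2 B : R, 0 <= B &
  forall z, 0 <= Re z -> normc (kernel_num z) <= B.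
Proof.
have [d d0 h] := delay_den_lb; have g0 := delay_gain_ge0.
have dV : 0 <= 2 / d by rewrite divr_ge0 // ltW.
exists (2 / d + 1 + delay_gain * 3).
  by rewrite !addr_ge0 // mulr_ge0.
move=> z z0; apply: (le_trans (normcB _ _)); apply: lerD.
  apply: (le_trans (normcB _ _)); rewrite normc1 lerD2r !normcM normcV normc_nat2.
  rewrite ler_pM ?mulr_ge0 ?invr_ge0 ?normc_ge0 //.
    by rewrite ler_piMr // normc_delay_exp.
  by rewrite lef_pV2 ?posrE ?(lt_le_trans d0) ?h.
rewrite normcM normc_rc ger0_norm // ler_wpM2l //; exact: cayley0_le.
Qed.

(** The factor 1 + s z of [dcayley] is unbounded, but |z| <= |D z| + 1, so one of the two factors D
    z in the denominator absorbs it. *)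
Lemma dkernel_num_bounded : exists2 B : R, 0 <= B &
  forall z, 0 <= Re z -> normc (dkernel_num z) <= B.
Proof.
have [d d0 h] := delay_den_lb; have g0 := delay_gain_ge0.
have dV : 0 <= d^-1 by rewrite invr_ge0 ltW.
exists (2 * ((1 + s) * d^-1 ^+ 2 + s * d^-1) + delay_gain * 2).
  apply: addr_ge0; last by rewrite mulr_ge0.
  apply: mulr_ge0 => //; apply: addr_ge0; last by rewrite mulr_ge0.
  by apply: mulr_ge0; [rewrite addr_ge0|rewrite exprn_ge0].
move=> z z0; apply: (le_trans (normcD _ _)); apply: lerD.
  rewrite normcM normcV normcX normc_opp !normcM normc_nat2.
  set D := normc (delay_den z).
  have D0 : 0 < D by rewrite (lt_le_trans d0) ?h.
  have E1 := normc_delay_exp z0.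
  have zD : normc z <= D + 1.
    have -> : z = delay_den z - delay_exp z by rewrite /delay_den addrK.
    by apply: (le_trans (normcB _ _)); rewrite lerD2l.
  have n1 : normc (1 + rc s * z) <= (1 + s) + s * D.
    apply: (le_trans (normcD _ _)); rewrite normc1 normcM normc_rc ger0_norm //.
    have : s * normc z <= s * (D + 1) by rewrite ler_wpM2l.
    lra.
  have DV : D^-1 <= d^-1 by rewrite lef_pV2 ?posrE // h.
  have DV0 : 0 <= D^-1 by rewrite invr_ge0 ltW.
  rewrite -mulrA -mulrA ler_wpM2l //.
  apply: (@le_trans _ _ (1 * (((1 + s) + s * D) / D ^+ 2))).
    apply: ler_pM => //; rewrite ?mulr_ge0 ?normc_ge0 ?invr_ge0 ?exprn_ge0 ?normc_ge0 //.
    by rewrite ler_wpM2r // invr_ge0 exprn_ge0 ?normc_ge0.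
  have -> : 1 * (((1 + s) + s * D) / D ^+ 2) = (1 + s) * D^-1 ^+ 2 + s * D^-1.
    by field; rewrite gt_eqF.
  apply: lerD; rewrite ler_wpM2l // ?addr_ge0 //.
  by rewrite lerXn2r.
rewrite !normcM normc_rc ger0_norm // ler_wpM2l // normcV normcX normc_nat2.
have o1 := normc_oneD_ge1 z0.
rewrite ler_pdivrMr ?exprn_gt0 ?(lt_le_trans ltr01) // ler_peMr //.
by rewrite exprn_ege1.
Qed.

Lemma norm_sub_le_of_derive (f df : R -> R) (x y : R) :
  (forall u : R, is_derive u (1 : R) f (df u)) -> (forall u, `|df u| <= 1) ->
  `|f x - f y| <= `|x - y|.
Proof.
move=> fd fb; wlog xy : x y / y <= x => [H|].
  have [yx|/ltW yx] := leP y x; first exact: H.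
  by rewrite distrC (distrC x) H.
have [|c _ ->] := @MVT_segment R f df y x xy (fun u _ => fd u).
  by apply/continuous_subspaceT => u; exact/differentiable_continuous/derivable1_diffP.
by rewrite normrM ler_piMl.
Qed.

(** At [i] the modulus of the exponential is 1. In each component, E u - v = (E - 1) u + (u - v)
    costs s |z - i| once for the modulus and once for the cosine or sine; two components give the
    constant 4 s. *)
Lemma delay_exp_lip z : 0 <= Re z ->
  normc (delay_exp z - delay_exp i) <= 4 * s * normc (z - i).
Proof.
move=> z0.
have r1 : Re z <= normc (z - i).
  by have := normc_Re (z - i); rewrite ReImE /= subr0 ger0_norm.
have r2 : `|Im z - 1| <= normc (z - i).
  by have := normc_Im (z - i); rewrite ReImE /=.
set r := normc (z - i) in r1 r2 *.
set E := expR (- (s * Re z)).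
have E1 : `|E - 1| <= s * r.
  have : 1 - s * Re z <= E by exact: expR_ge1Dx.
  have : E <= 1 by rewrite /E -expR0 ler_expR oppr_le0 mulr_ge0.
  have : s * Re z <= s * r by rewrite ler_wpM2l.
  by rewrite ler_norml => *; apply/andP; split; lra.
have lc : `|cos (s * Im z) - cos s| <= s * r.
  apply: (le_trans (@norm_sub_le_of_derive cos (fun x => - sin x) _ _ _ _)).
    by move=> u; rewrite normrN sin_max.
  have -> : s * Im z - s = s * (Im z - 1) by ring.
  by rewrite normrM ger0_norm // ler_wpM2l.
have ls : `|sin (s * Im z) - sin s| <= s * r.
  apply: (le_trans (@norm_sub_le_of_derive sin cos _ _ _ _)).
    by move=> u; rewrite cos_max.
  have -> : s * Im z - s = s * (Im z - 1) by ring.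
  by rewrite normrM ger0_norm // ler_wpM2l.
apply: (le_trans (normc_le _)).
rewrite !delay_expE !ReImE /= mulr0 oppr0 expR0 mulr1 !mul1r -/E.
have h (u v : R) : `|u| <= 1 -> `|u - v| <= s * r -> `|E * u - v| <= 2 * s * r.
  move=> u1 uv; have -> : E * u - v = (E - 1) * u + (u - v) by ring.
  apply: (le_trans (ler_normD _ _)).
  have : `|(E - 1) * u| <= s * r * 1 by rewrite normrM ler_pM.
  lra.
have h1 := h _ _ (cos_max (s * Im z)) lc.
have h2 := h _ _ (sin_max (s * Im z)) ls.
rewrite -opprD normrN; lra.
Qed.

(** This equation determines [delay_gain]: the numerator of the kernel vanishes at [i]. After
    clearing denominators it reduces to C cos s = 1 + sin s and C (1 - sin s) = cos s, which agree
    because cos^2 + sin^2 = 1. *)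
Lemma cayley_i : cayley i = rc delay_gain * cayley0 i.
Proof.
have D0 : delay_den i != 0 by apply: delay_den_neq0.
have O0 : 1 + i != 0 by apply: oneD_neq0.
have S1 : 1 - sin s != 0 by rewrite subr_eq0 gt_eqF // sin_delay_lt1.
have gc : delay_gain * cos s = 1 + sin s.
  have := cos2sin2 s; rewrite expr2 /delay_gain => h.
  by rewrite mulrAC h; field.
have gS : delay_gain * (1 - sin s) = cos s by rewrite divfK.
have ei : delay_exp i = Complex (cos s) (- sin s).
  by rewrite delay_expE /= mulr0 oppr0 expR0 !mul1r mulr1.
apply: (mulIf D0); apply: (mulIf O0).
have -> : cayley i * delay_den i * (1 + i) = (delay_exp i - i) * (1 + i).
  rewrite /cayley; move: D0; rewrite /delay_den => D0; by field.
have -> : rc delay_gain * cayley0 i * delay_den i * (1 + i) =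
    rc delay_gain * ((1 - i) * (i + delay_exp i)).
  by rewrite /cayley0 /delay_den; field.
rewrite ei; apply: complex_eqP; rewrite !ReImE /=.
  transitivity (delay_gain * cos s + delay_gain * (1 - sin s)); last by ring.
  by rewrite gc gS; ring.
transitivity (delay_gain * (1 - sin s) - delay_gain * cos s); last by ring.
by rewrite gc gS; ring.
Qed.

(** A quantitative form of the zero at [i], uniform on the whole half-plane; it will cancel the pole
    of 1 / (1 + z^2). *)
Lemma kernel_num_lip : exists2 B : R, 0 <= B &
  forall z, 0 <= Re z -> normc (kernel_num z) <= B * normc (z - i).
Proof.
have [d d0 h] := delay_den_lb; have g0 := delay_gain_ge0.
have i0 : 0 <= Re i by [].
have dV0 : 0 <= d^-1 by rewrite invr_ge0 ltW.
exists (2 * (4 * s + 1) * (d^-1 * d^-1) + delay_gain * 2).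
  apply: addr_ge0; last by rewrite mulr_ge0.
  by do 2?[apply: mulr_ge0 => //]; rewrite ?addr_ge0 ?mulr_ge0.
move=> z z0.
have D0 := delay_den_neq0 z0; have Di0 := delay_den_neq0 i0.
have O0 := oneD_neq0 z0; have Oi0 := oneD_neq0 i0.
(* Subtracting the identity at [i] leaves differences of Cayley transforms; over the common
   denominator D z * D i the numerator is i exp(- s z) - z exp(- s i), which splits into two terms
   of order |z - i|. *)
have -> : kernel_num z =
    2 * (i * (delay_exp z - delay_exp i) - (z - i) * delay_exp i) *
      ((delay_den z)^-1 * (delay_den i)^-1)
    - rc delay_gain * (2 * (- (z - i)) * ((1 + z)^-1 * (1 + i)^-1)).
  rewrite /kernel_num; transitivity ((cayley z - cayley i) -
     rc delay_gain * (cayley0 z - cayley0 i)); first by rewrite cayley_i; ring.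
  congr (_ - _ * _).
    rewrite /cayley; move: D0 Di0; rewrite /delay_den => D0 Di0.
    by field; apply/andP; split.
  by rewrite /cayley0; field; apply/andP; split.
rewrite [X in _ <= X]mulrDl; apply: (le_trans (normcB _ _)).
set r := normc (z - i); have r0 : 0 <= r by exact: normc_ge0.
have iv (w : R[i]) : 0 <= Re w -> normc (delay_den w)^-1 <= d^-1.
  by move=> w0; rewrite normcV lef_pV2 ?posrE ?(lt_le_trans d0) ?h.
have ov (w : R[i]) : 0 <= Re w -> normc (1 + w)^-1 <= 1.
  move=> w0; have o1 := normc_oneD_ge1 w0.
  by rewrite normcV invf_le1 // (lt_le_trans ltr01).
apply: lerD.
  rewrite normcM [X in _ <= X](_ : _ = 2 * ((4 * s + 1) * r) * (d^-1 * d^-1)); last by ring.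
  apply: ler_pM; rewrite ?normc_ge0 //; last first.
    by rewrite normcM ler_pM ?normc_ge0 // iv.
  rewrite normcM normc_nat2 ler_wpM2l //; apply: (le_trans (normcB _ _)).
  rewrite !normcM normc_i mul1r -/r.
  have := delay_exp_lip z0; rewrite -/r => h1.
  have : r * normc (delay_exp i) <= r * 1 by rewrite ler_wpM2l // normc_delay_exp.
  lra.
rewrite normcM normc_rc ger0_norm // -[X in _ <= X]mulrA ler_wpM2l // normcM.
rewrite -[X in _ <= X]mulr1; apply: ler_pM; rewrite ?normc_ge0 //.
  by rewrite normcM normc_nat2 normc_opp.
by rewrite normcM -[X in _ <= X]mulr1 ler_pM ?normc_ge0 // ov.
Qed.

Lemma dist_opp_i_ge z : 0 <= Im z -> 1 + Im z <= normc (z + i).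
Proof.
move=> x0; have := normc_Im (z + i); rewrite Im_add /= ger0_norm ?addr_ge0 //.
by rewrite addrC.
Qed.

Lemma oneDIm_le z : 0 <= Im z -> 1 + Im z <= 2 + normc (z - i).
Proof.
move=> x0; have := normc_Im (z - i); rewrite !ReImE /=.
by have := ler_norm (Im z - 1); lra.
Qed.

Lemma inv_sqr_oneDle (x : R) : 0 <= x -> (1 + x)^-1 ^+ 2 <= (1 + x ^+ 2)^-1.
Proof.
move=> x0; rewrite exprVn lef_pV2 ?posrE; last 2 first.
- by rewrite exprn_gt0 // ltr_wpDr.
- by rewrite ltr_wpDr // sqr_ge0.
by nra.
Qed.

(** In (z - i) (z + i) the second factor is at least 1 + Im z in modulus. The first is compensated
    near [i] by the zero of the numerator, and far from [i] it is itself of order 1 + Im z. The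
    majorant does not involve Re z, so it serves both for lines tending to the imaginary axis and
    for lines going to infinity. *)
Lemma delay_kernel_bounded : exists2 B : R, 0 <= B &
  forall z, 0 <= Re z -> 0 <= Im z -> z != i ->
  normc (delay_kernel z) <= B / (1 + Im z ^+ 2).
Proof.
have [B1 B10 h1] := kernel_num_bounded.
have [B2 B20 h2] := kernel_num_lip.
exists (3 * (B1 + B2)); first by rewrite mulr_ge0 // addr_ge0.
move=> z z0 x0 zi; rewrite /delay_kernel oneD_sqr_factor.
have r0 : 0 < normc (z - i) by rewrite normc_gt0 subr_eq0.
have x1 : 0 < 1 + Im z by rewrite ltr_wpDr.
have hx := oneDIm_le x0; have hp := dist_opp_i_ge x0.
have hn : normc (kernel_num z) * (1 + Im z) <= 3 * (B1 + B2) * normc (z - i).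
  have := h1 _ z0; have := h2 _ z0; have := normc_ge0 (kernel_num z).
  move: (normc (kernel_num z)) (normc (z - i)) r0 hx => m r r0 hx m0 m2 m1.
  (* Since 1 + Im z <= 2 + r, it is at most 3 r when r >= 1, where boundedness of the numerator
     suffices, and at most 3 when r < 1, where the Lipschitz bound is used. *)
  have [r1|r1] := lerP 1 r.
    have : m * (1 + Im z) <= B1 * (3 * r) by apply: ler_pM => //; lra.
    have : 0 <= B2 * r by rewrite mulr_ge0 // ltW.
    nra.
  have : m * (1 + Im z) <= (B2 * r) * 3 by apply: ler_pM => //; lra.
  have : 0 <= B1 * r by rewrite mulr_ge0 // ltW.
  nra.
rewrite normcM normcV normcM.
apply: (@le_trans _ _ (3 * (B1 + B2) * (1 + Im z)^-1 ^+ 2)); last first.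
  by rewrite ler_wpM2l ?inv_sqr_oneDle // mulr_ge0 // addr_ge0.
rewrite invfM expr2 !mulrA; apply: ler_pM.
- by rewrite mulr_ge0 ?invr_ge0 ?normc_ge0.
- by rewrite invr_ge0 normc_ge0.
- by rewrite ler_pdivrMr // mulrAC ler_pdivlMr.
- by rewrite lef_pV2 ?posrE // (lt_le_trans x1).
Qed.

Lemma sub_i_neq0 z : 0 < Re z -> z - i != 0.
Proof.
by move=> z0; rewrite subr_eq0; apply/eqP => zi; move: z0; rewrite zi ltxx.
Qed.

Lemma Re_le_dist_i z : Re z <= normc (z - i).
Proof.
apply: (le_trans _ (normc_Re _)); rewrite !ReImE /= subr0; exact: ler_norm.
Qed.

(** Away from the imaginary axis |z - i| >= a, so no cancellation at [i] is called for and the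
    constant may depend on a. *)
Lemma ddelay_kernel_bounded (a : R) : 0 < a -> exists2 B : R, 0 <= B &
  forall z, a <= Re z -> 0 <= Im z ->
  normc (ddelay_kernel z) <= B / (1 + Im z ^+ 2).
Proof.
move=> a0.
have [B1 B10 h1] := kernel_num_bounded.
have [B3 B30 h3] := dkernel_num_bounded.
have aV : 0 < a^-1 by rewrite invr_gt0.
exists ((B3 + 4 * B1 * a^-1) * (2 * a^-1 + 1)).
  by rewrite !(addr_ge0, mulr_ge0) // ltW.
move=> z az x0; have z0 : 0 < Re z by exact: lt_le_trans az.
have ra := le_trans az (Re_le_dist_i z).
have r0 : 0 < normc (z - i) := lt_le_trans a0 ra.
have x1 : 0 < 1 + Im z by rewrite ltr_wpDr.
have hx := oneDIm_le x0; have hp := dist_opp_i_ge x0.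
have p0 : 0 < normc (z + i) := lt_le_trans x1 hp.
have zp : normc z <= 2 * normc (z + i).
  have {1}-> : z = (z + i) - i by rewrite addrK.
  by apply: (le_trans (normcB _ _)); rewrite normc_i; lra.
have m1 := h1 _ (ltW z0); have m3 := h3 _ (ltW z0).
apply: (le_trans (normcB _ _)); rewrite oneD_sqr_factor !normcM !normcV normcX !normcM.
rewrite normc_nat2.
have := normc_ge0 (kernel_num z); have := normc_ge0 (dkernel_num z).
move: (normc (kernel_num z)) (normc (dkernel_num z)) m1 m3 => k k' kB k'B k'0 k0.
move: (normc (z - i)) (normc (z + i)) (normc z) (normc_ge0 z) ra r0 p0 hx hp zp
  => r p m m0 ra r0 p0 hx hp zp.
have rV : r^-1 <= a^-1 by rewrite lef_pV2 ?posrE.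
have rV0 : 0 <= r^-1 by rewrite invr_ge0 ltW.
have pV : p^-1 <= (1 + Im z)^-1 by rewrite lef_pV2 ?posrE.
have pV0 : 0 <= p^-1 by rewrite invr_ge0 ltW.
(* From (1 + Im z) / r <= (2 + r) / r and r >= a. *)
have rx : r^-1 <= (2 * a^-1 + 1) * (1 + Im z)^-1.
  rewrite ler_pdivlMr // mulrC ler_pdivrMr //.
  have : 1 <= a^-1 * r by rewrite mulrC ler_pdivlMr // mul1r.
  nra.
have e2 : 2 * m * k / (r * p) ^+ 2 <= 4 * B1 * a^-1 * (r^-1 * p^-1).
  have -> : 2 * m * k / (r * p) ^+ 2 = (2 * (m * p^-1)) * k * (r^-1 * (r^-1 * p^-1)).
    by field; apply/andP; split; rewrite gt_eqF.
  have -> : 4 * B1 * a^-1 * (r^-1 * p^-1) = (2 * 2) * B1 * (a^-1 * (r^-1 * p^-1)).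
    by ring.
  have mp : m * p^-1 <= 2 by rewrite ler_pdivrMr.
  have mp0 : 0 <= m * p^-1 by rewrite mulr_ge0.
  by rewrite !ler_pM ?mulr_ge0 // ler_wpM2l.
have e1 : k' / (r * p) <= B3 * (r^-1 * p^-1).
  by rewrite invfM ler_wpM2r // mulr_ge0.
apply: (le_trans (lerD e1 e2)); rewrite -mulrDl.
rewrite -[X in _ <= X]mulrA; apply: ler_wpM2l.
  by rewrite !(addr_ge0, mulr_ge0) // ltW.
apply: (@le_trans _ _ ((2 * a^-1 + 1) * (1 + Im z)^-1 ^+ 2)); last first.
  by rewrite ler_wpM2l ?inv_sqr_oneDle // addr_ge0 // mulr_ge0 // ltW.
by rewrite expr2 mulrA ler_pM.
Qed.

(** Gives the pointwise limit 0 when the vertical line moves to infinity. *)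
Lemma delay_kernel_decay : exists2 B : R, 0 <= B &
  forall z, 0 < Re z -> 0 <= Im z -> normc (delay_kernel z) <= B / Re z.
Proof.
have [B1 B10 h1] := kernel_num_bounded; exists B1 => // z z0 x0.
rewrite /delay_kernel oneD_sqr_factor normcM normcV normcM.
have r0 : 0 < normc (z - i) := lt_le_trans z0 (Re_le_dist_i z).
have p1 : 1 <= normc (z + i) by apply: le_trans (dist_opp_i_ge x0); rewrite lerDl.
apply: ler_pM; [exact: normc_ge0| |exact/h1/ltW|].
  by rewrite invr_ge0 mulr_ge0 ?normc_ge0.
rewrite lef_pV2 ?posrE //; last by rewrite mulr_gt0 // (lt_le_trans ltr01).
by apply: (le_trans (Re_le_dist_i z)); rewrite ler_peMr // ltW.
Qed.

(** * The kernel on the coordinate axes *)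

Lemma delay_den_sqr (x : R) :
  Re (delay_den (Complex 0 x)) ^+ 2 + Im (delay_den (Complex 0 x)) ^+ 2 =
  x ^+ 2 - 2 * x * sin (s * x) + 1.
Proof.
rewrite /delay_den delay_expE !ReImE /= mulr0 oppr0 expR0 !mul1r add0r.
by rewrite cos2sin2; ring.
Qed.

(** On the imaginary axis 1 + z^2 = 1 - x^2 is real. The real part of (e - z) times the conjugate of
    e + z is |e|^2 - |z|^2 = 1 - x^2, for e = exp(- s z) as well as for e = 1, so both Cayley
    transforms contribute this factor and it cancels. *)
Lemma Re_delay_kernel_imaginary (x : R) : 0 <= x -> x != 1 ->
  Re (delay_kernel (Complex 0 x)) =
  (x ^+ 2 - 2 * x * sin (s * x) + 1)^-1 - delay_gain / (1 + x ^+ 2).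
Proof.
move=> x0 x1; set z := Complex 0 x; rewrite /delay_kernel.
have q0 : x ^+ 2 - 2 * x * sin (s * x) + 1 != 0.
  by rewrite -delay_den_sqr; apply/sqr_ReIm_neq0/delay_den_neq0.
have o0 : 1 + x ^+ 2 != 0 by rewrite gt_eqF // ltr_wpDr // sqr_ge0.
have m0 : 1 - x ^+ 2 != 0.
  rewrite -[1](expr1n _ 2) subr_sqr mulf_neq0 //; first by rewrite subr_eq0 eq_sym.
  by rewrite gt_eqF // ltr_wpDr.
have -> : 1 + z ^+ 2 = rc (1 - x ^+ 2).
  by apply: complex_eqP; rewrite expr2 !ReImE /=; ring.
have ReC : Re (cayley z) = (1 - x ^+ 2) / (x ^+ 2 - 2 * x * sin (s * x) + 1).
  have -> : cayley z = (delay_exp z - z) / delay_den z.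
    have D0 : delay_den z != 0 by apply: delay_den_neq0.
    by rewrite /cayley; move: D0; rewrite /delay_den => D0; field.
  rewrite Re_mul Re_inv Im_inv delay_den_sqr /delay_den delay_expE !ReImE /=.
  rewrite mulr0 oppr0 expR0 !mul1r.
  have h := cos2sin2 (s * x).
  transitivity ((cos (s * x) ^+ 2 + sin (s * x) ^+ 2 - x ^+ 2) /
    (x ^+ 2 - 2 * x * sin (s * x) + 1)); first by field.
  by rewrite h; field.
have ReC0 : Re (cayley0 z) = (1 - x ^+ 2) / (1 + x ^+ 2).
  rewrite /cayley0 !ReImE Re_inv Im_inv !ReImE /= !addr0 !add0r.
  by field.
have Rq (w : R[i]) (y : R) : y != 0 -> Re (w / rc y) = Re w / y.
  by move=> y0; case: w => u v; rewrite Re_mul Re_inv Im_inv /=; field.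
have Rg (w : R[i]) (y : R) : Re (rc y * w) = y * Re w.
  by case: w => u v; rewrite Re_mul /=; ring.
rewrite Rq // /kernel_num Re_add Re_opp Rg ReC ReC0.
by field; rewrite ?q0 ?o0 ?m0.
Qed.

(** The kernel has real coefficients. This kills the boundary term at the real axis, so that
    integrals over upper half-lines suffice. *)
Lemma Im_delay_kernel_real (a : R) : Im (delay_kernel (Complex a 0)) = 0.
Proof.
have ImV0 (z : R[i]) : Im z = 0 -> Im z^-1 = 0 by move=> h; rewrite Im_inv h mul0r oppr0.
have ImM0 (z z' : R[i]) : Im z = 0 -> Im z' = 0 -> Im (z * z') = 0.
  by move=> h h'; rewrite Im_mul h h' mulr0 mul0r addr0.
have ImD0 (z z' : R[i]) : Im z = 0 -> Im z' = 0 -> Im (z + z') = 0.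
  by move=> h h'; rewrite Im_add h h' addr0.
have ImN0 (z : R[i]) : Im z = 0 -> Im (- z) = 0 by move=> h; rewrite Im_opp h oppr0.
have e0 : Im (delay_exp (Complex a 0)) = 0.
  by rewrite delay_expE /= mulr0 sin0 mulr0 oppr0.
have n1 : Im (1 : R[i]) = 0 by [].
have n2 : Im (2 : R[i]) = 0 by rewrite /= addr0.
rewrite /delay_kernel /kernel_num /cayley /cayley0 /delay_den expr2.
have a0 : Im (Complex a 0) = 0 by [].
have g0 : Im (rc delay_gain) = 0 by [].
apply: (ImM0); last by apply: (ImV0); apply: (ImD0) => //; apply: (ImM0).
apply: (ImD0); [|apply: (ImN0); apply: (ImM0) => //].
- apply: (ImD0); last exact: ImN0.
  by apply: (ImM0); [exact: ImM0|exact/ImV0/ImD0].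
- apply: (ImD0); last exact: ImN0.
  by apply: (ImM0) => //; exact/ImV0/ImD0.
Qed.

(** * Integrals over the half-line with a Cauchy majorant *)

Local Notation mu := (@lebesgue_measure R).
Local Notation Rpos := [set` @Interval R (BLeft 0%R) +oo%O].

Lemma continuous_measurable_Rpos (f : R -> R) : continuous f -> measurable_fun Rpos f.
Proof. by move=> cf; apply: measurable_funTS; exact: continuous_measurable_fun. Qed.

Lemma continuous_emeasurable_Rpos (f : R -> R) : continuous f ->
  measurable_fun Rpos (EFin \o f).
Proof. by move=> cf; apply/measurable_EFinP; exact: continuous_measurable_Rpos. Qed.

Lemma continuous_cauchy (B : R) : continuous (fun x : R => B / (1 + x ^+ 2)).
Proof. by move=> x; apply: cvgM; [exact: cvg_cst|exact: continuous_oneDsqrV]. Qed.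

Lemma oneDsqr_gt0 (x : R) : 0 < 1 + x ^+ 2.
Proof. by rewrite ltr_wpDr // sqr_ge0. Qed.

Lemma Rintegral0y_cauchy (B : R) : 0 <= B ->
  mu.-integrable Rpos (EFin \o (fun x : R => B / (1 + x ^+ 2))) /\
  \int[mu]_(x in Rpos) (B / (1 + x ^+ 2)) = B * (pi / 2).
Proof.
move=> B0.
have m1 : measurable_fun Rpos (EFin \o (fun x : R => (oneDsqr x)^-1)).
  by apply: continuous_emeasurable_Rpos; exact: continuous_oneDsqrV.
have i1 : mu.-integrable Rpos (EFin \o (fun x : R => (oneDsqr x)^-1)).
  apply/integrableP; split => //.
  rewrite (_ : (\int[mu]_(x in Rpos) _)%E = (pi / 2)%:E) ?ltry //.
  rewrite -integral0y_oneDsqr; apply: eq_integral => x _ /=.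
  by rewrite ger0_norm // invr_ge0 ltW // oneDsqr_gt0.
split.
  by apply: (@integrableZl _ _ _ mu Rpos _ B (EFin \o (fun x : R => (oneDsqr x)^-1))).
by rewrite RintegralZl //; rewrite /Rintegral integral0y_oneDsqr.
Qed.

Lemma integrable0y_dominated (f : R -> R) (B : R) : 0 <= B ->
  measurable_fun Rpos f ->
  (forall x, 0 <= x -> `|f x| <= B / (1 + x ^+ 2)) ->
  mu.-integrable Rpos (EFin \o f).
Proof.
move=> B0 mf fB.
apply: (le_integrable _ _ _ (Rintegral0y_cauchy B0).1) => //.
  exact/measurable_EFinP.
move=> x /=; rewrite in_itv /= andbT => x0; rewrite lee_fin.
rewrite [X in _ <= X]ger0_norm ?fB //.
by rewrite divr_ge0 // ltW // oneDsqr_gt0.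
Qed.

Lemma Rintegral0y_FTC (f F : R -> R) (B l : R) : 0 <= B -> continuous f ->
  (forall x, is_derive x (1 : R) F (f x)) ->
  (forall x, 0 <= x -> `|f x| <= B / (1 + x ^+ 2)) ->
  F x @[x --> +oo] --> l ->
  \int[mu]_(x in Rpos) f x = l - F 0.
Proof.
move=> B0 cf dF fB Fl.
have [ig Ig] := Rintegral0y_cauchy B0.
have mf : measurable_fun Rpos f.
  exact: continuous_measurable_Rpos.
have if_ := integrable0y_dominated B0 mf fB.
(* Adding the majorant reduces the claim to non-negative integrands. *)
pose G x := F x + B * atan x.
have dG (x : R) : is_derive x (1 : R) G (f x + B / (1 + x ^+ 2)).
  apply: (is_derive_eq (derive_add (dF x)
    (derive_mul (is_derive_cst B x (1 : R)) (is_derive1_atan x)))).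
  by rewrite mul0r add0r.
have cG (x : R) : {for x, continuous G}.
  by have [dx _] := dG x; exact/differentiable_continuous/derivable1_diffP.
have GL : G x @[x --> +oo] --> l + B * (pi / 2).
  by apply: cvgD => //; apply: cvgM; [exact: cvg_cst|exact: cvgy_atan].
have : \int[mu]_(x in Rpos) (f x + B / (1 + x ^+ 2)) =
    (l + B * (pi / 2)) - G 0.
  apply: Rintegral_ge0_continuous_FTC2y GL _ _ _.
  - move=> x x0; have := fB x x0; rewrite ler_norml => /andP[h _].
    by rewrite -lerBlDr sub0r.
  - apply: continuous_subspaceT => x.
    by apply: cvgD; [exact: cf|exact: continuous_cauchy].
  - by move=> x _; have [] := dG x.
  - by apply: cvg_at_right_filter; exact: cG.
  - by move=> x _; rewrite derive1E; have [_ ->] := dG x.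
rewrite RintegralD // Ig /G atan0 mulr0 addr0 => /eqP.
by rewrite addrAC (inj_eq (addIr _)) => /eqP.
Qed.

(** * Shifting the vertical line of integration *)

Lemma oneD_sqr_neq0 z : 0 < Re z -> 1 + z ^+ 2 != 0.
Proof.
move=> z0; rewrite oneD_sqr_factor mulf_neq0 ?sub_i_neq0 //.
by apply/eqP => /(congr1 (@complex.Re R)); rewrite Re_add /= addr0 => h; rewrite h ltxx in z0.
Qed.

Lemma Im_mul_i z : Im (z * i) = Re z.
Proof. by case: z => x y; rewrite Im_mul /= mulr1 mulr0 addr0. Qed.

Lemma cderive_horizontal (a x : R) : cderive (fun u : R => Complex u x) a 1.
Proof. by split; [exact: is_derive_id|exact: is_derive_cst]. Qed.

Lemma cderive_vertical (a x : R) : cderive (fun u : R => Complex a u) x i.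
Proof. by split; [exact: is_derive_cst|exact: is_derive_id]. Qed.

(** The value of the second derivative is left existential: only the continuity of [ddelay_kernel]
    along vertical lines will be drawn from it. *)
Lemma cderive_ddelay_kernel (f : R -> R[i]) (t : R) z' :
  0 < Re (f t) -> cderive f t z' ->
  exists w, cderive (fun u => ddelay_kernel (f u)) t w.
Proof.
move=> ft0 df.
have D0 := delay_den_neq0 (ltW ft0); have O0 := oneD_neq0 (ltW ft0).
have Q0 := oneD_sqr_neq0 ft0.
have de := cderive_cexp (cderiveN (cderiveM (cderive_cst t (rc s)) df)).
have dd := cderiveD df de.
have cst := @cderive_cst R t.
have dW := cderiveD (cderiveM (cderiveM (cst 2) de) (cderiveV D0 dd)) (cst (-1)).
have dO := cderiveD (cst 1) df.
have dW0 := cderiveD (cderiveM (cst 2) (cderiveV O0 dO)) (cst (-1)).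
have dnum := cderiveD dW (cderiveN (cderiveM (cst (rc delay_gain)) dW0)).
have dQ := cderiveV Q0 (cderiveD (cst 1) (cderiveM df df)).
have dOV := cderiveV O0 dO; have dDV := cderiveV D0 dd.
have dnumd := cderiveD (cderiveM (cderiveN (cderiveM (cderiveM (cst 2) de)
    (cderiveD (cst 1) (cderiveM (cst (rc s)) df)))) (cderiveM dDV dDV))
  (cderiveM (cst (rc delay_gain)) (cderiveM (cst 2) (cderiveM dOV dOV))).
have dall := cderiveD (cderiveM dnumd dQ)
  (cderiveN (cderiveM (cderiveM (cderiveM (cst 2) df) dnum) (cderiveM dQ dQ))).
eexists; apply: cderive_ext dall => u.
rewrite /ddelay_kernel /dkernel_num /dcayley /kernel_num /cayley /cayley0.
by rewrite !expr2 !invfM.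
Qed.

Definition kernel_re (a x : R) := Re (delay_kernel (Complex a x)).

Lemma continuous_kernel_re (a : R) : 0 < a -> continuous (kernel_re a).
Proof.
move=> a0 x; apply: (ccontinuous_Re (cderive_delay_kernel _ _ (cderive_vertical a x))).
  exact: ltW.
exact: oneD_sqr_neq0.
Qed.

Lemma integrable_kernel_re (a : R) : 0 < a ->
  mu.-integrable Rpos (EFin \o kernel_re a).
Proof.
move=> a0; have [B B0 h] := delay_kernel_bounded.
apply: (integrable0y_dominated B0).
  by apply: continuous_measurable_Rpos; exact: continuous_kernel_re.
move=> x x0; apply: (le_trans (normc_Re _)); apply: h => //=; first exact: ltW.
by rewrite -subr_eq0; apply: sub_i_neq0.
Qed.

Lemma cvgy_cauchy (B : R) : (B / (1 + x ^+ 2)) @[x --> +oo] --> (0 : R).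
Proof.
apply/cvgrPdist_le => e e0; near=> x.
have x1 : 1 <= x by near: x; apply: nbhs_pinfty_ge; rewrite num_real.
have xB : `|B| / e <= x by near: x; apply: nbhs_pinfty_ge; rewrite num_real.
rewrite sub0r normrN normrM normfV (ger0_norm (ltW (oneDsqr_gt0 x))).
rewrite ler_pdivrMr ?oneDsqr_gt0 //.
have : `|B| <= x * e by rewrite -ler_pdivrMr.
have : x * e <= (1 + x ^+ 2) * e by rewrite ler_wpM2r // ?ltW //; nra.
lra.
Unshelve. all: by end_near. Qed.

(** Along a vertical line the derivative of K in x is j K', so Re K' is the derivative of Im K. The
    latter vanishes at infinity by the decay bound and at x = 0 because K is real on the real
    axis. *)
Lemma Rintegral_ddelay_kernel (a : R) : 0 < a ->
  \int[mu]_(x in Rpos) Re (ddelay_kernel (Complex a x)) = 0.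
Proof.
move=> a0; have [B' B'0 h'] := ddelay_kernel_bounded a0.
have [B B0 h] := delay_kernel_bounded.
pose v x := Im (delay_kernel (Complex a x)).
transitivity (0 - v 0); last by rewrite /v Im_delay_kernel_real subr0.
apply: (@Rintegral0y_FTC (fun x => Re (ddelay_kernel (Complex a x))) v B' 0 B'0).
- move=> x; have [w dw] := @cderive_ddelay_kernel (fun u => Complex a u) x _ a0 (cderive_vertical a x).
  exact: (ccontinuous_Re dw).
- move=> x; have [_] := @cderive_delay_kernel (fun u => Complex a u) x i (ltW a0)
    (@oneD_sqr_neq0 (Complex a x) a0) (cderive_vertical a x).
  by rewrite Im_mul_i.
- by move=> x x0; apply: (le_trans (normc_Re _)); apply: h'.
- apply: (@squeeze_cvgr _ _ _ _ (fun x => - B / (1 + x ^+ 2))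
    (fun x => B / (1 + x ^+ 2))); [|exact: cvgy_cauchy..].
  near=> x; have x0 : 0 <= x by near: x; apply: nbhs_pinfty_ge; rewrite num_real.
  rewrite mulNr -ler_norml; apply: (le_trans (normc_Im _)); apply: h => //=.
    exact: ltW.
  by rewrite -subr_eq0; apply: sub_i_neq0.
Unshelve. all: by end_near. Qed.

(** Differentiation under the integral on the window ]a / 2, 2 a[, where the bound of
    [ddelay_kernel_bounded] taken at a / 2 is a common majorant; the resulting integral of Re K' is
    zero. *)
Lemma is_derive_kernel_integral (a : R) : 0 < a ->
  is_derive a (1 : R) (fun b => \int[mu]_(x in Rpos) kernel_re b x) 0.
Proof.
move=> a0; have a2 : 0 < a / 2 by rewrite divr_gt0.
have [B B0 h] := ddelay_kernel_bounded a2.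
have Ia : `]a / 2, 2 * a[%classic a by rewrite /= in_itv /=; apply/andP; split; lra.
have pos (b : R) : `]a / 2, 2 * a[%classic b -> 0 < b.
  by rewrite /= in_itv /= => /andP[/(lt_trans a2)].
have dk (b x : R) : 0 < b -> is_derive b (1 : R) (kernel_re ^~ x)
    (Re (ddelay_kernel (Complex b x))).
  move=> b0; have [] := @cderive_delay_kernel (fun u => Complex u x) b 1 (ltW b0)
    (@oneD_sqr_neq0 (Complex b x) b0) (cderive_horizontal b x).
  by rewrite mulr1.
have intk (b : R) : `]a / 2, 2 * a[%classic b ->
    mu.-integrable Rpos (EFin \o kernel_re b).
  by move=> /pos; exact: integrable_kernel_re.
have derk (b x : R) : `]a / 2, 2 * a[%classic b -> Rpos x ->
    derivable (kernel_re ^~ x) b 1.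
  by move=> /pos b0 _; have [] := dk b x b0.
have G0 (x : R) : 0 <= B / (1 + x ^+ 2) by rewrite divr_ge0 // ltW // oneDsqr_gt0.
have Gub (b x : R) : `]a / 2, 2 * a[%classic b -> Rpos x ->
    `|partial1of2 kernel_re b x| <= B / (1 + x ^+ 2).
  move=> Ib; rewrite /= in_itv /= andbT => x0; rewrite partial1of2E.
  have [_ ->] := dk b x (pos _ Ib); apply: (le_trans (normc_Re _)); apply: h => //=.
  by move: Ib; rewrite /= in_itv /= => /andP[/ltW].
have ib := (Rintegral0y_cauchy B0).1.
apply: DeriveDef.
  by apply: (@derivable_under_integral R _ _ mu kernel_re Rpos _ a (a / 2) (2 * a) Ia
    intk derk _ G0 ib Gub).
rewrite -derive1E -[RHS](Rintegral_ddelay_kernel a0).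
transitivity (\int[mu]_(x in Rpos) partial1of2 kernel_re a x).
  by apply: (@differentiation_under_integral R _ _ mu kernel_re Rpos _ a (a / 2) (2 * a) Ia
    intk derk _ G0 ib Gub).
apply: eq_Rintegral => x _.
by rewrite partial1of2E; have [_ ->] := dk a x a0.
Qed.

Lemma kernel_integral_cst (a b : R) : 0 < a -> 0 < b ->
  \int[mu]_(x in Rpos) kernel_re a x = \int[mu]_(x in Rpos) kernel_re b x.
Proof.
(* The substitution a = exp t turns the positive abscissae into the whole line, where a vanishing
   derivative forces constancy. *)
move=> a0 b0; pose J t := \int[mu]_(x in Rpos) kernel_re (expR t) x.
have dJ (t : R) : is_derive t (1 : R) J 0.
  apply: (is_derive_eq (@is_derive1_comp _
    (fun b => \int[mu]_(x in Rpos) kernel_re b x) expR t _ _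
    (is_derive_kernel_integral (expR_gt0 t)) (is_derive_expR t))).
  by rewrite mul0r.
by have := is_derive_0_is_cst (ln a) (ln b) dJ; rewrite /J !lnK // posrE.
Qed.

(** The integral is the same on all lines Re z = n + 1, while dominated convergence sends it to 0 as
    n grows. *)
Lemma kernel_integral_eq0 : \int[mu]_(x in Rpos) kernel_re 1 x = 0.
Proof.
have [B B0 h] := delay_kernel_bounded.
have [B' B'0 h'] := delay_kernel_decay.
have n0 (n : nat) : (0 : R) < n.+1%:R by [].
have [] := @dominated_convergence _ _ R mu Rpos (measurable_itv _)
  (fun n x => (kernel_re n.+1%:R x)%:E) (EFin \o cst 0)
  (EFin \o (fun x => B / (1 + x ^+ 2))).
- move=> n; apply: continuous_emeasurable_Rpos.
  exact: continuous_kernel_re.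
- apply: (@continuous_emeasurable_Rpos (cst 0)); exact: cst_continuous.
- apply: aeW => x; rewrite /= in_itv /= andbT => x0.
  apply: cvg_EFin; first exact: nearW.
  have hB : (B' * harmonic n) @[n --> \oo] --> (0 : R).
    by rewrite -(mulr0 B'); apply: cvgM; [exact: cvg_cst|exact: cvg_harmonic].
  apply: (@squeeze_cvgr _ _ _ _ (fun n => - (B' * harmonic n))
    (fun n => B' * harmonic n)) => //; last first.
    by rewrite -oppr0; exact: cvgN.
  apply: nearW => n; rewrite -ler_norml; apply: (le_trans (normc_Re _)).
  exact: h'.
- exact: (Rintegral0y_cauchy B0).1.
- apply: aeW => x n; rewrite /= in_itv /= andbT => x0; rewrite lee_fin.
  apply: (le_trans (normc_Re _)); apply: h => //=.
  by rewrite -subr_eq0; apply: sub_i_neq0.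
move=> _ _; rewrite [X in _ --> X]integral0_eq // => /fine_cvg.
have -> : (fine \o [sequence (\int[mu]_(x in Rpos) (kernel_re n.+1%:R x)%:E)%E]_n)
  = cst (\int[mu]_(x in Rpos) kernel_re 1 x).
  by apply/funext => n /=; exact: (kernel_integral_cst (n0 n) ltr01).
by move=> hc; exact: (cvg_unique (@Rhausdorff R) (cvg_cst _) hc).
Qed.

(** * Passage to the imaginary axis *)

Definition delay_weight (x : R) := x ^+ 2 - 2 * x * sin (s * x) + 1.

Lemma delay_weight_gt0 (x : R) : 0 < delay_weight x.
Proof.
rewrite /delay_weight -delay_den_sqr lt_neqAle eq_sym.
by rewrite sqr_ReIm_neq0 ?delay_den_neq0 //= addr_ge0 // sqr_ge0.
Qed.

Lemma continuous_delay_weightV : continuous (fun x => (delay_weight x)^-1).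
Proof.
move=> x; apply: cvgV; first by rewrite gt_eqF // delay_weight_gt0.
apply: cvgD; last exact: cvg_cst.
apply: cvgB; first exact: exprn_continuous.
apply: cvgM; first by apply: cvgM; [exact: cvg_cst|exact: cvg_id].
apply: (@cvg_comp _ _ _ (fun y => s * y) sin); last exact: continuous_sin.
by apply: cvgM; [exact: cvg_cst|exact: cvg_id].
Qed.

(** Here [delay_weight] is |D(j x)|^2. The lines Re z = 1 / (n + 1) approach the imaginary axis,
    where Re K is the difference of the wanted integrand and C / (1 + x^2); the limit of the
    vanishing integrals equates the two. *)
Lemma Rintegral0y_delay_weight :
  mu.-integrable Rpos (EFin \o (fun x => (delay_weight x)^-1)) /\
  \int[mu]_(x in Rpos) (delay_weight x)^-1 = delay_gain * (pi / 2).
Proof.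
have [B B0 h] := delay_kernel_bounded.
have [ic Ic] := Rintegral0y_cauchy delay_gain_ge0.
have hp (n : nat) : 0 < harmonic n :> R by rewrite /harmonic /= invr_gt0.
pose q x := (delay_weight x)^-1 - delay_gain / (1 + x ^+ 2).
have cq : continuous q.
  by move=> x; apply: cvgB; [exact: continuous_delay_weightV|exact: continuous_cauchy].
have [] := @dominated_convergence _ _ R mu Rpos (measurable_itv _)
  (fun n x => (kernel_re (harmonic n) x)%:E) (EFin \o q)
  (EFin \o (fun x => B / (1 + x ^+ 2))).
- move=> n; apply: continuous_emeasurable_Rpos.
  exact: continuous_kernel_re.
- exact: continuous_emeasurable_Rpos.
(* Convergence is only claimed off x = 1: there the limit point is [i], where the quotient defining
   the kernel takes the default value 0. *)
- exists [set 1]; split => //; first exact: lebesgue_measure_set1.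
  move=> x /=; apply: contra_notP => x1; rewrite in_itv /= andbT => x0.
  have {}x1 : x != 1 by apply/eqP.
  apply: cvg_EFin; first exact: nearW.
  rewrite /q -Re_delay_kernel_imaginary //.
  apply: (@cvg_comp _ _ _ harmonic (kernel_re ^~ x)); first exact: cvg_harmonic.
  apply: (ccontinuous_Re (cderive_delay_kernel _ _ (cderive_horizontal 0 x))) => //=.
  rewrite oneD_sqr_factor mulf_neq0 //.
    by apply/eqP => /(congr1 (@complex.Im R)); rewrite !ReImE /= => /eqP; rewrite subr_eq0 (negPf x1).
  apply/eqP => /(congr1 (@complex.Im R)); rewrite !ReImE /= => /eqP.
  by rewrite gt_eqF // ltr_wpDl.
- exact: (Rintegral0y_cauchy B0).1.
- apply: aeW => x n; rewrite /= in_itv /= andbT => x0; rewrite lee_fin.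
  apply: (le_trans (normc_Re _)); apply: h => //=.
  by rewrite -subr_eq0; apply: sub_i_neq0 => /=.
move=> iq _ cvgq.
have Iq : \int[mu]_(x in Rpos) q x = 0.
  have qfin : (\int[mu]_(x in Rpos) (EFin \o q) x)%E \is a fin_num.
    exact: integrable_fin_num.
  rewrite /Rintegral; move: cvgq; rewrite -(fineK qfin) => /fine_cvg.
  have -> : (fine \o [sequence (\int[mu]_(x in Rpos)
      (kernel_re (harmonic n) x)%:E)%E]_n) = cst 0.
    apply/funext => n /=; apply: etrans kernel_integral_eq0.
    exact: (kernel_integral_cst (hp n) ltr01).
  by move=> hc; exact: (cvg_unique (@Rhausdorff R) hc (cvg_cst _)).
have wE : (fun x => (delay_weight x)^-1) = (fun x => q x + delay_gain / (1 + x ^+ 2)).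
  by apply/funext => x; rewrite /q subrK.
rewrite wE; split; last by rewrite RintegralD // Iq Ic add0r.
by apply: (integrableD _ iq ic).
Qed.

Lemma integral_delay_weight :
  (\int[mu]_x ((delay_weight x)^-1)%:E = (delay_gain * pi)%:E)%E.
Proof.
have [iw Iw] := Rintegral0y_delay_weight.
rewrite ge0_symfun_integralT; last 3 first.
- by move=> x; rewrite invr_ge0 ltW // delay_weight_gt0.
- exact: continuous_delay_weightV.
- by move=> x /=; rewrite /delay_weight sqrrN !mulrN !sinN mulrNN.
rewrite -set_itvcy.
have -> : (\int[mu]_(x in Rpos) ((delay_weight x)^-1)%:E)%E =
    (delay_gain * (pi / 2))%:E.
  by rewrite -Iw /Rintegral fineK //; exact: integrable_fin_num iw.
by rewrite -EFinM; congr EFin; field.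
Qed.

End DelayKernel.

(** * Real symmetric matrices *)

Section SpectralTheorem.
Variable R : rcfType.

(** Over the complex numbers the matrix is Hermitian, hence unitarily diagonalisable with real
    spectrum; being an eigenvalue then descends along the embedding of the real field. *)
Lemma symmetric_eigenvalue n (A : 'M[R]_n.+1) : A^T = A -> exists l, eigenvalue A l.
Proof.
move=> symA; pose f := real_complex R; pose B := map_mx f A.
have Bherm : B \is hermsymmx.
  apply: realsym_hermsym.
    apply/is_hermitianmxP; rewrite expr0 scale1r map_mx_id //.
    by rewrite /B map_trmx symA.
  by apply/mxOverP => i j; rewrite mxE complex_real.
have /hermitian_normalmx/orthomx_spectralP BE := Bherm.
have /mxOverP/(_ 0 0)/RRe_real lR := hermitian_spectral_diag_real Bherm.
set l := spectral_diag B 0 0 in lR.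
exists (complex.Re l); rewrite -(eigenvalue_map f) -/B.
rewrite [X in eigenvalue _ X](_ : _ = l); last exact: lR.
have Pu := spectral_unit B.
apply/eigenvalueP; exists (row 0 (spectralmx B)).
  have BP : spectralmx B *m B = diag_mx (spectral_diag B) *m spectralmx B.
    by rewrite {2}BE !mulmxA mulmxV // mul1mx.
  rewrite -row_mul BP; apply/rowP => j.
  by rewrite mul_diag_mx !mxE.
apply/eqP => r0; move: Pu; rewrite -row_free_unit => /row_freeP [Q PQ].
have := congr1 (row 0) PQ; rewrite row_mul r0 mul0mx => /rowP/(_ 0).
by rewrite !mxE eqxx => /eqP; rewrite eq_sym oner_eq0.
Qed.

(** The reflection in the hyperplane orthogonal to w = v - e sends v to e: both have norm 1, whence
    2 w^T v = w^T w. For v = e the identity serves. *)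
Lemma householder n (v : 'cV[R]_n.+1) : v^T *m v = 1%:M ->
  exists2 Q : 'M[R]_n.+1, Q^T = Q /\ Q *m Q = 1%:M & Q *m v = delta_mx 0 0.
Proof.
move=> v1; pose e := delta_mx 0 0 : 'cV[R]_n.+1.
pose w := v - e; pose c : R := (w^T *m w) 0 0.
have [w0|w0] := eqVneq w 0.
  exists 1%:M; first by rewrite trmx1 mulmx1.
  by rewrite mul1mx; apply/eqP; rewrite -subr_eq0; apply/eqP.
have cE : w^T *m w = c%:M by rewrite [LHS]mx11_scalar.
have e1 : e^T *m e = 1%:M.
  by apply/matrixP => i j; rewrite !ord1 trmx_delta mul_delta_mx !mxE.
have evC : e^T *m v = v^T *m e.
  by rewrite -[RHS]trmxK trmx_mul trmxK [e^T *m v]mx11_scalar tr_scalar_mx.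
have c0 : c != 0.
  apply: contra_neq w0 => c0; apply/matrixP => i j; rewrite ord1 [RHS]mxE.
  move: c0; rewrite /c mxE => /eqP; rewrite psumr_eq0; last first.
    by move=> k _; rewrite mxE -expr2 sqr_ge0.
  by move=> /allP/(_ i (mem_index_enum _)); rewrite mxE mulf_eq0 orbb => /eqP.
have wv : 2 *: (w^T *m v) = c%:M.
  have wT : w^T = v^T - e^T by rewrite /w linearB.
  have -> : w^T *m v = 1%:M - v^T *m e by rewrite wT mulmxBl v1 evC.
  rewrite -cE {1}wT /w mulmxBl !mulmxBr v1 e1 evC scaler_nat mulr2n.
  by rewrite opprB.
pose Q := 1%:M - (2 / c) *: (w *m w^T).
have wwT : (w *m w^T)^T = w *m w^T by rewrite trmx_mul trmxK.
have ww2 : (w *m w^T) *m (w *m w^T) = c *: (w *m w^T).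
  by rewrite mulmxA -(mulmxA w) cE mul_mx_scalar scalemxAl.
exists Q; first split.
- by rewrite /Q linearB linearZ /= trmx1 wwT.
- rewrite /Q mulmxBl mul1mx mulmxBr mulmx1 -scalemxAl -scalemxAr ww2 !scalerA.
  have -> : 2 / c * (2 / c) * c = 2 / c + 2 / c by field.
  by rewrite scalerDl opprB addrK subrK.
rewrite /Q mulmxBl mul1mx -scalemxAl -mulmxA.
have -> : w^T *m v = (c / 2)%:M.
  have -> : (c / 2)%:M = 2^-1 *: (2 *: (w^T *m v)) :> 'M[R]_1.
    by rewrite wv scale_scalar_mx mulrC.
  by rewrite scalerA mulVf ?scale1r // pnatr_eq0.
rewrite mul_mx_scalar scalerA.
have -> : 2 / c * (c / 2) = 1 by field.
by rewrite scale1r /w opprB addrC subrK.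
Qed.

(** Deflation: a Householder reflection [Q] moves a unit eigenvector to the first basis vector, so Q
    A Q is block diagonal with first block l, and induction applies to the other block. *)
Lemma spectral_theorem n (A : 'M[R]_n) : A^T = A ->
  exists (U : 'M[R]_n) (d : 'rV[R]_n),
    U *m U^T = 1%:M /\ A = U *m diag_mx d *m U^T.
Proof.
elim: n A => [|n IH] A symA.
  by exists 0, 0; split; apply/matrixP => [[]].
have [l /eigenvalueP[u uA u0]] := symmetric_eigenvalue symA.
pose r := (u *m u^T) 0 0.
have r0 : 0 < r.
  rewrite /r mxE lt_neqAle sumr_ge0 ?andbT; last by move=> k _; rewrite mxE -expr2 sqr_ge0.
  apply: contra_neq u0 => /esym/eqP; rewrite psumr_eq0; last first.
    by move=> k _; rewrite mxE -expr2 sqr_ge0.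
  move=> /allP h; apply/rowP => k; have := h k (mem_index_enum _).
  by rewrite !mxE mulf_eq0 orbb => /eqP.
pose v := (Num.sqrt r)^-1 *: u^T.
have v1 : v^T *m v = 1%:M.
  rewrite /v [(_ *: _)^T]linearZ /= trmxK -scalemxAl -scalemxAr scalerA [u *m _]mx11_scalar -/r.
  rewrite scale_scalar_mx -expr2 exprVn sqr_sqrtr ?ltW // mulVf //.
  by rewrite gt_eqF.
have Av : A *m v = l *: v.
  rewrite /v -scalemxAr scalerA [l * _]mulrC -scalerA; congr (_ *: _).
  by rewrite -{1}symA -trmx_mul uA linearZ.
have [Q [symQ QQ] Qv] := householder v1.
have [B BQ] : {B : 'M[R]_(1 + n) | B = Q *m A *m Q} by exists (Q *m A *m Q).
have Be : B *m (delta_mx 0 0 : 'cV_(1 + n)) = l *: delta_mx 0 0.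
  by rewrite BQ -{1}Qv -!mulmxA (mulmxA Q Q) QQ mul1mx Av -scalemxAr Qv.
have symB : B^T = B by rewrite BQ !trmx_mul symQ symA mulmxA.
have B0 (i j : 'I_(1 + n)) : j = 0 :> nat -> B i j = l * (val i == 0)%:R.
  move=> j0; have -> : j = 0 by exact: val_inj.
  by have /matrixP/(_ i 0) := Be; rewrite -colE !mxE eqxx andbT.
have B0' (i j : 'I_(1 + n)) : j = 0 :> nat -> B j i = l * (val i == 0)%:R.
  by move=> j0; rewrite -symB mxE B0.
pose A' := drsubmx B.
have symA' : A'^T = A' by rewrite /A' trmx_drsub symB.
have BE : B = block_mx l%:M 0 0 A'.
  rewrite -[LHS]submxK; congr block_mx; apply/matrixP => i j; rewrite !ord1 !mxE.
  - by rewrite B0 // mulr1.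
  - by rewrite B0' // mulr0.
  - by rewrite B0 // mulr0.
have [U [d [UU AE]]] := IH _ symA'.
pose V : 'M[R]_(1 + n) := block_mx 1%:M 0 0 U.
have VV : V *m V^T = 1%:M.
  rewrite /V tr_block_mx !trmx0 trmx1 mulmx_block !mulmx0 !mul0mx !addr0 !add0r.
  by rewrite mulmx1 UU -scalar_mx_block.
exists (Q *m V), (row_mx (l%:M : 'M[R]_1) d); split.
  by rewrite trmx_mul symQ mulmxA -(mulmxA Q) VV mulmx1.
have -> : A = Q *m B *m Q.
  by rewrite BQ !mulmxA QQ mul1mx -mulmxA QQ mulmx1.
have -> : B = V *m diag_mx (row_mx l%:M d) *m V^T.
  rewrite BE /V tr_block_mx !trmx0 trmx1 diag_mx_row !mulmx_block.
  rewrite !mulmx0 !mul0mx !addr0 !add0r mulmx1 mul1mx -AE ?mulmx0 ?mul0mx.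
  congr block_mx; apply/matrixP => i j; rewrite !ord1 !mxE //.
by rewrite trmx_mul symQ !mulmxA.
Qed.

End SpectralTheorem.

(** * Functional calculus in an orthonormal eigenbasis *)

Section DiagonalCalculus.
Variables (F : fieldType) (n : nat) (U : 'M[F]_n).
Hypothesis UU : U *m U^T = 1%:M.
Implicit Types p q : 'I_n -> F.

(** Indexed by functions on the modes, so that identities between functions of the Laplacian become
    pointwise identities between eigenvalues. The field is arbitrary because the calculus is used
    both over the reals and, with the same real orthogonal basis, over the complex numbers. *)
Definition spmx p : 'M[F]_n := U *m diag_mx (\row_k p k) *m U^T.

Lemma spmxE p i j : spmx p i j = \sum_k p k * (U i k * U j k).
Proof.
by rewrite /spmx mul_mx_diag mxE; apply: eq_bigr => k _; rewrite !mxE mulrA [p k * _]mulrC.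
Qed.

Lemma eq_spmx p q : p =1 q -> spmx p = spmx q.
Proof. by move=> pq; apply/matrixP => i j; rewrite !spmxE; under eq_bigr do rewrite pq. Qed.

Lemma spmxM p q : spmx p *m spmx q = spmx (fun k => p k * q k).
Proof.
rewrite /spmx !mulmxA -(mulmxA _ U^T) (mulmx1C UU) mulmx1 -(mulmxA U).
rewrite mulmx_diag; congr (_ *m diag_mx _ *m _).
by apply/rowP => k; rewrite !mxE.
Qed.

Lemma spmx1 : spmx (fun=> 1) = 1%:M.
Proof.
rewrite /spmx (_ : diag_mx _ = 1%:M) ?mulmx1 //.
by apply/matrixP => i j; rewrite !mxE.
Qed.

Lemma spmxD p q : spmx p + spmx q = spmx (fun k => p k + q k).
Proof.
apply/matrixP => i j; rewrite mxE !spmxE -big_split; apply: eq_bigr => k _.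
by rewrite mulrDl.
Qed.

Lemma spmxZ a p : a *: spmx p = spmx (fun k => a * p k).
Proof.
by apply/matrixP => i j; rewrite mxE !spmxE mulr_sumr; apply: eq_bigr => k _; rewrite mulrA.
Qed.

Lemma spmxB p q : spmx p - spmx q = spmx (fun k => p k - q k).
Proof. by rewrite -scaleN1r spmxZ spmxD; apply: eq_spmx => k; rewrite mulN1r. Qed.

Lemma spmxX p k : spmx p ^+ k = spmx (fun l => p l ^+ k).
Proof.
elim: k => [|k IH]; first by rewrite expr0; exact: esym spmx1.
by rewrite exprS IH -mulmxE spmxM; apply: eq_spmx => l; rewrite exprS.
Qed.

Lemma spmx_sum (I : eqType) (r : seq I) (g : I -> 'I_n -> F) :
  \sum_(k <- r) spmx (g k) = spmx (fun l => \sum_(k <- r) g k l).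
Proof.
apply/matrixP => i j; rewrite summxE spmxE.
under eq_bigr do rewrite spmxE; rewrite exchange_big; apply: eq_bigr => k _.
by rewrite mulr_suml.
Qed.

Lemma tr_spmx p : (spmx p)^T = spmx p.
Proof. by rewrite /spmx !trmx_mul trmxK tr_diag_mx mulmxA. Qed.

Lemma mxtrace_spmx p : \tr (spmx p) = \sum_k p k.
Proof.
rewrite /spmx mxtrace_mulC mulmxA (mulmx1C UU) mul1mx mxtrace_diag.
by apply: eq_bigr => k _; rewrite mxE.
Qed.

Lemma invmx_spmx p : (forall k, p k != 0) -> invmx (spmx p) = spmx (fun k => (p k)^-1).
Proof.
move=> p0; have h : spmx p *m spmx (fun k => (p k)^-1) = 1%:M.
  by rewrite spmxM -spmx1; apply: eq_spmx => k; rewrite mulfV.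
have [pu _] := mulmx1_unit h.
by rewrite -[LHS]mulmx1 -h mulmxA mulVmx // mul1mx.
Qed.

Lemma spmx_eigenvalue p l : eigenvalue (spmx p) l -> exists k, l = p k.
Proof.
case/eigenvalueP => v vp v0.
have uv : v *m U != 0.
  apply: contra_neq v0 => h; by rewrite -[v]mulmx1 -UU mulmxA h mul0mx.
have [k wk] : exists k, (v *m U) 0 k != 0.
  apply/existsP; apply: contraNT uv; rewrite negb_exists => /forallP h.
  by apply/eqP/rowP => k; rewrite [RHS]mxE; apply/eqP; rewrite -[_ == _]negbK h.
exists k; have := congr1 (fun x => (x *m U) 0 k) vp.
rewrite /spmx !mulmxA -mulmxA (mulmx1C UU) mulmx1 -scalemxAl mul_mx_diag.
rewrite [LHS]mxE [RHS]mxE [X in _ * X]mxE => h; apply: esym.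
by apply: (mulIf wk); rewrite mulrC.
Qed.

Lemma eigenvalue_spmx p k : eigenvalue (spmx p) (p k).
Proof.
apply/eigenvalueP; exists (col k U)^T.
  have UTp : U^T *m spmx p = diag_mx (\row_l p l) *m U^T.
    by rewrite /spmx !mulmxA (mulmx1C UU) mul1mx.
  rewrite tr_col -row_mul UTp; apply/rowP => j.
  by rewrite mul_diag_mx !mxE.
apply/eqP => h; have := congr1 (fun A => (A *m U) 0 k) h.
rewrite mul0mx tr_col -row_mul (mulmx1C UU) !mxE eqxx => /eqP.
by rewrite oner_eq0.
Qed.

Lemma spmx_col p k : spmx p *m col k U = p k *: col k U.
Proof.
have UTp : spmx p *m U = U *m diag_mx (\row_l p l).
  by rewrite /spmx -!mulmxA (mulmx1C UU) mulmx1.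
rewrite !colE mulmxA UTp -!colE; apply/colP => j.
by rewrite mul_mx_diag !mxE mulrC.
Qed.

Lemma spmx_quad p (x : 'cV[F]_n) :
  (x^T *m spmx p *m x) 0 0 = \sum_k p k * ((U^T *m x) k 0) ^+ 2.
Proof.
have -> : x^T *m spmx p *m x =
    (U^T *m x)^T *m diag_mx (\row_k p k) *m (U^T *m x).
  by rewrite /spmx trmx_mul trmxK !mulmxA.
rewrite mxE; apply: eq_bigr => k _.
by rewrite mul_mx_diag [in LHS]mxE ![(_^T *m _)^T _ _]mxE ![(\row__ _) _ _]mxE; ring.
Qed.

End DiagonalCalculus.

(** * Pseudo-inverse, cosine and sine of a symmetric matrix *)

Section PseudoInverse.
Variables (R : realType) (n : nat).
Implicit Types A X Y : 'M[R]_n.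

(** A X = (A Y) (A X), and transposing this product of symmetric matrices gives (A X) (A Y) = A Y;
    likewise on the other side. *)
Lemma penrose_uniq A X Y : penrose A X -> penrose A Y -> X = Y.
Proof.
move=> [x1 x2 x3 x4] [y1 y2 y3 y4].
have AXY : A *m X = A *m Y.
  have e1 : A *m X = (A *m Y) *m (A *m X) by rewrite mulmxA y1.
  have e2 : (A *m X) *m (A *m Y) = A *m Y by rewrite mulmxA x1.
  by rewrite e1 -[LHS]trmxK trmx_mul x3 y3 e2 y3.
have XAY : X *m A = Y *m A.
  have e1 : X *m A = (X *m A) *m (Y *m A) by rewrite -mulmxA (mulmxA A) y1.
  have e2 : (Y *m A) *m (X *m A) = Y *m A by rewrite -mulmxA (mulmxA A) x1.
  by rewrite e1 -[LHS]trmxK trmx_mul x4 y4 e2 y4.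
by rewrite -x2 -mulmxA AXY mulmxA XAY y2.
Qed.

Lemma mpinvE A X : penrose A X -> mpinv A = X.
Proof.
move=> AX; rewrite /mpinv; case: xgetP => [Y -> AY|/(_ X)//].
exact: penrose_uniq AY AX.
Qed.

Variables (U : 'M[R]_n).
Hypothesis UU : U *m U^T = 1%:M.

(** The convention 0^-1 = 0 is exactly what the pseudo-inverse does on the kernel. *)
Lemma mpinv_spmx p : mpinv (spmx U p) = spmx U (fun k => (p k)^-1).
Proof.
apply: mpinvE; split; rewrite ?spmxM ?tr_spmx //; apply: eq_spmx => k.
  by have [->|h] := eqVneq (p k) 0; rewrite ?mul0r // mulfV // mul1r.
by have [->|h] := eqVneq (p k) 0; rewrite ?invr0 ?mul0r // mulVf // mul1r.
Qed.

Lemma lim_spmx (g : nat -> 'I_n -> R) (l : 'I_n -> R) i j :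
  (forall k, g N k @[N --> \oo] --> l k) ->
  limn (fun N => spmx U (g N) i j) = spmx U l i j.
Proof.
move=> gl; apply/cvg_lim => //; rewrite spmxE.
rewrite (_ : (fun N => _) = (fun N => \sum_k g N k * (U i k * U j k))); last first.
  by apply/funext => N; rewrite spmxE.
apply: (@cvg_big _ _ +%R); first exact: add_continuous.
by move=> k _; apply: cvgM; [exact: gl|exact: cvg_cst].
Qed.

Lemma cosmx_spmx p : cosmx (spmx U p) = spmx U (fun k => cos (p k)).
Proof.
apply/matrixP => i j; rewrite mxE.
rewrite -(lim_spmx (g := fun N k => series (cos_coeff' (p k)) N)); last first.
  by move=> k; exact: cvg_cos_coeff'.
congr (limn _); apply/funext => N.
under eq_bigr do rewrite spmxX // spmxZ.
rewrite spmx_sum; apply: (congr1 (fun A : 'M[R]_n => A i j)); apply: eq_spmx => k.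
rewrite /series /= big_mkord; apply: eq_bigr => l _.
by rewrite /cos_coeff' mulrAC.
Qed.

Lemma sinmx_spmx p : sinmx (spmx U p) = spmx U (fun k => sin (p k)).
Proof.
apply/matrixP => i j; rewrite mxE.
rewrite -(lim_spmx (g := fun N k => series (sin_coeff' (p k)) N)); last first.
  by move=> k; exact: cvg_sin_coeff'.
congr (limn _); apply/funext => N.
under eq_bigr do rewrite spmxX // spmxZ.
rewrite spmx_sum; apply: (congr1 (fun A : 'M[R]_n => A i j)); apply: eq_spmx => k.
rewrite /series /= big_mkord; apply: eq_bigr => l _.
by rewrite /sin_coeff' mulrAC.
Qed.

End PseudoInverse.

(** * The transfer function in the eigenbasis *)

Section TransferFunction.
Variables (R : realType) (n : nat) (U : 'M[R]_n) (d : 'I_n -> R).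
Hypothesis UU : U *m U^T = 1%:M.

Let V := map_mx (fun r : R => Complex r 0) U.

Lemma Cmx_real_complex (A : 'M[R]_n) : Cmx A = map_mx (real_complex R) A.
Proof. by []. Qed.

Lemma Cmx_unitary : V *m V^T = 1%:M.
Proof.
rewrite /V -[map_mx _ _]/(map_mx (real_complex R) U) map_trmx -map_mxM UU.
by rewrite map_mx1.
Qed.

Lemma Cmx_spmx p : Cmx (spmx U p) = spmx V (fun k => Complex (p k) 0).
Proof.
rewrite /spmx Cmx_real_complex !map_mxM map_trmx map_diag_mx.
congr (_ *m diag_mx _ *m _).
by apply/rowP => k; rewrite !mxE.
Qed.

(** [Gtf] is diagonal in the eigenbasis and [Mn] removes the consensus mode. For d k = 0 the second
    hypothesis says that omega is not 0, which makes the inverted matrix regular. *)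
Lemma trGHG_spmx tau omega : Mn R n = spmx U (fun k => (d k != 0)%:R) ->
  (forall k, omega ^+ 2 - 2 * omega * d k * sin (omega * tau) + d k ^+ 2 != 0) ->
  trGHG (spmx U d) tau omega = \sum_(k | d k != 0)
    (omega ^+ 2 - 2 * omega * d k * sin (omega * tau) + d k ^+ 2)^-1.
Proof.
move=> ME nz; have VV := Cmx_unitary.
(* The eigenvalues j omega + exp(- j omega tau) d k of the matrix to be inverted. *)
pose z k := Complex (cos (omega * tau) * d k) (omega - sin (omega * tau) * d k).
have zE k : complex.Re (z k) ^+ 2 + complex.Im (z k) ^+ 2 =
    omega ^+ 2 - 2 * omega * d k * sin (omega * tau) + d k ^+ 2.
  by rewrite /= exprMn cos2sin2; ring.
have z0 k : z k != 0.
  apply: contra_neq (nz k) => zk; rewrite -zE zk /= expr0n /= addr0 //.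
have GE : Gtf (spmx U d) tau omega =
    spmx V (fun k => (d k != 0)%:R * (z k)^-1).
  rewrite /Gtf ME !Cmx_spmx -(spmx1 VV) !spmxZ spmxD.
  rewrite (_ : spmx V _ = spmx V (fun k => (d k != 0)%:R)); last first.
    by apply: eq_spmx => k; case: (d k != 0).
  rewrite [X in invmx X](_ : _ = spmx V z); last first.
    apply: eq_spmx => k; rewrite /z.
    by apply: complex_eqP; rewrite !ReImE /=; ring.
  by rewrite invmx_spmx // spmxM.
have GH : (map_mx (@conjc R) (Gtf (spmx U d) tau omega))^T =
    spmx V (fun k => (d k != 0)%:R * conjc (z k)^-1).
  rewrite GE; apply/matrixP => i j; rewrite [LHS]mxE [LHS]mxE !spmxE rmorph_sum /=.
  apply: eq_bigr => k _; rewrite rmorphM rmorphM /= rmorph_nat; congr (_ * _).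
  rewrite rmorphM /= !mxE mulrC; congr (_ * _);
  by apply: complex_eqP; rewrite /= ?oppr0.
rewrite /trGHG GH GE spmxM // mxtrace_spmx //.
rewrite (big_morph (@complex.Re R) (id1 := 0) (op1 := +%R)) //; last first.
  by move=> x y; rewrite Re_add.
rewrite [RHS]big_mkcond; apply: eq_bigr => k _.
have [dk|dk] := eqVneq (d k) 0.
  by rewrite (_ : (~~ true)%:R = 0 :> R[i]) // !mul0r.
rewrite (_ : (~~ false)%:R = 1 :> R[i]) // !mul1r -zE.
transitivity (complex.Re (z k) ^+ 2 + complex.Im (z k) ^+ 2)^-1; last by [].
have cj (w : R[i]) : complex.Re (conjc w * w) = complex.Re w ^+ 2 + complex.Im w ^+ 2.
  by case: w => x y; rewrite Re_mul /=; ring.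
rewrite cj Re_inv Im_inv; have := sqr_ReIm_neq0 (z0 k).
by move: (complex.Re (z k)) (complex.Im (z k)) => x y xy0; field.
Qed.

End TransferFunction.

(** * The performance of a single mode *)

Section ModeIntegral.
Variables (R : realType) (tau lam : R).
Hypotheses (tau_ge0 : 0 <= tau) (lam_gt0 : 0 < lam) (tl_lt : tau * lam < pi / 2).

Local Notation mu := (@lebesgue_measure R).

(** This is |j x + l exp(- j t x)|^2; [mode_cost] is the function f of the overview. *)
Definition mode_weight (t l x : R) := x ^+ 2 - 2 * x * l * sin (x * t) + l ^+ 2.
Definition mode_cost (t l : R) := cos (t * l) / (2 * l * (1 - sin (t * l))).

Lemma mode_weightE (y : R) :
  mode_weight tau lam (lam * y) = lam ^+ 2 * delay_weight (tau * lam) y.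
Proof.
rewrite /mode_weight /delay_weight.
have -> : lam * y * tau = tau * lam * y by ring.
by ring.
Qed.

Let tl_ge0 : 0 <= tau * lam. Proof. by rewrite mulr_ge0 // ltW. Qed.

Lemma mode_weight_gt0 (x : R) : 0 < mode_weight tau lam x.
Proof.
have -> : x = lam * (x / lam) by rewrite mulrC divfK // gt_eqF.
by rewrite mode_weightE mulr_gt0 ?exprn_gt0 // delay_weight_gt0.
Qed.

Lemma continuous_mode_weightV : continuous (fun x => (mode_weight tau lam x)^-1).
Proof.
move=> x; apply: cvgV; first by rewrite gt_eqF // mode_weight_gt0.
apply: cvgD; last exact: cvg_cst.
apply: cvgB; first exact: exprn_continuous.
apply: cvgM.
  apply: cvgM; last exact: cvg_cst.
  by apply: cvgM; [exact: cvg_cst|exact: cvg_id].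
apply: (@cvg_comp _ _ _ (fun y => y * tau) sin); last exact: continuous_sin.
by apply: cvgM; [exact: cvg_id|exact: cvg_cst].
Qed.

Lemma integral_mode_weight :
  (\int[mu]_x ((mode_weight tau lam x)^-1)%:E = (2 * pi * mode_cost tau lam)%:E)%E.
Proof.
pose F (x : R) := lam * x.
have dF (x : R) : is_derive x (1 : R) F lam.
  apply: (is_derive_eq (derive_mul (is_derive_cst lam x (1 : R)) (is_derive_id x (1 : R)))).
  by rewrite mul0r add0r mulr1.
have F'E : F^`()%classic = cst lam.
  by apply/funext => x; rewrite derive1E; have [_ ->] := dF x.
rewrite (@increasing_ge0_integration_by_substitutionT R F); first last.
- by move=> x; rewrite invr_ge0 ltW // mode_weight_gt0.
- exact: continuous_mode_weightV.
- exact: (gt0_cvgMry lam_gt0).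
- exact: (gt0_cvgMrNy lam_gt0).
- by move=> x; have [] := dF x.
- by rewrite F'E; exact: is_cvg_cst.
- by rewrite F'E; exact: is_cvg_cst.
- by rewrite F'E; move=> x; exact: cvg_cst.
- by move=> x y xy; rewrite /F ltr_pM2l.
have -> : (fun x => ((((fun y => (mode_weight tau lam y)^-1) \o F) * F^`()%classic) x)%:E)
    = (fun x => (lam^-1)%:E * ((delay_weight (tau * lam) x)^-1)%:E)%E.
  apply/funext => x; rewrite F'E -EFinM; congr EFin.
  transitivity ((mode_weight tau lam (lam * x))^-1 * lam); first by [].
  have w0 := delay_weight_gt0 tl_ge0 tl_lt x.
  by rewrite mode_weightE; field; rewrite !gt_eqF.
have mw : measurable_fun [set: R] (fun x => ((delay_weight (tau * lam) x)^-1)%:E).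
  apply/measurable_EFinP; apply: continuous_measurable_fun.
  exact: (continuous_delay_weightV tl_ge0 tl_lt).
have w0 x : [set: R] x -> (0 <= ((delay_weight (tau * lam) x)^-1)%:E)%E.
  by move=> _; rewrite lee_fin invr_ge0 ltW // delay_weight_gt0.
rewrite (@ge0_integralZl _ _ _ mu setT _ _ mw _ w0) //; last first.
  by rewrite lee_fin invr_ge0 ltW.
rewrite integral_delay_weight // -EFinM /mode_cost /delay_gain; congr EFin.
have s1 : 1 - sin (tau * lam) != 0 by rewrite subr_eq0 gt_eqF // sin_delay_lt1.
by field; rewrite s1 gt_eqF.
Qed.

End ModeIntegral.

(** * The performance as a sum over the modes *)

Section SteadyState.
Variables (R : realType) (n : nat) (U : 'M[R]_n) (d : 'I_n -> R) (tau : R).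
Hypotheses (UU : U *m U^T = 1%:M) (ME : Mn R n = spmx U (fun k => (d k != 0)%:R)).
Hypotheses (d_ge0 : forall k, 0 <= d k) (tau_ge0 : 0 <= tau).
Hypothesis (td_lt : forall k, tau * d k < pi / 2).

Local Notation mu := (@lebesgue_measure R).

(* Thanks to [0^-1 = 0] the consensus mode needs no special treatment in sums over
   the spectrum. *)
Lemma mode_cost0 : mode_cost tau 0 = 0.
Proof. by rewrite /mode_cost !mulr0 mul0r invr0 mulr0. Qed.

Let d_gt0 k : d k != 0 -> 0 < d k. Proof. by move=> dk; rewrite lt_neqAle eq_sym dk d_ge0. Qed.

(* At [omega = 0] the matrix inverted in [Gtf] is singular and [invmx] returns it
   unchanged; that single frequency is negligible. *)
Lemma rho_ss_spmx : rho_ss (spmx U d) tau = \sum_k mode_cost tau (d k).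
Proof.
pose g k (x : R) : \bar R :=
  (if d k == 0 then 0 else (mode_weight tau (d k) x)^-1)%:E.
have cg k : measurable_fun [set: R] (g k).
  apply/measurable_EFinP; case: eqVneq => dk; first exact: measurable_cst.
  by apply: continuous_measurable_fun; apply: continuous_mode_weightV => //; exact: d_gt0.
have g0 k x : [set: R] x -> (0 <= g k x)%E.
  move=> _; rewrite /g lee_fin; case: eqVneq => dk //.
  by rewrite invr_ge0 ltW // mode_weight_gt0 // d_gt0.
have gE (x : R) : ([set: R] `\ 0) x -> (trGHG (spmx U d) tau x)%:E = (\sum_k g k x)%E.
  move=> [_ /= /eqP x0]; rewrite trGHG_spmx //; last first.
    move=> k; have [->|dk] := eqVneq (d k) 0.
      by rewrite mulr0 mul0r subr0 expr0n addr0 expf_neq0.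
    by rewrite gt_eqF // (mode_weight_gt0 tau_ge0 (d_gt0 dk)).
  rewrite /g sumEFin big_mkcond; congr EFin; apply: eq_bigr => k _.
  by case: eqVneq.
have mD : measurable ([set: R] `\ 0) by apply: measurableD.
have mG : measurable_fun [set: R] (fun x => \sum_k g k x)%E.
  by apply: emeasurable_sum.
have I1 : (\int[mu]_x (trGHG (spmx U d) tau x)%:E = \int[mu]_x (\sum_k g k x))%E.
  rewrite -(@integral_setD1 _ _ 0) //; last first.
    apply: (@eq_measurable_fun _ _ _ _ _ (fun x => \sum_k g k x)%E).
      by move=> x; rewrite inE => /gE ->.
    exact: measurable_funTS mG.
  rewrite -[RHS](@integral_setD1 _ _ 0) //; last exact: measurable_funTS mG.
  by apply: eq_integral => x; rewrite inE => /gE.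
rewrite /rho_ss /Rintegral I1 ge0_integral_sum //.
have -> : (\sum_k \int[mu]_x g k x = \sum_k (2 * pi * mode_cost tau (d k))%:E)%E.
  apply: eq_bigr => k _; rewrite /g; case: eqVneq => dk.
    by rewrite dk mode_cost0 mulr0 integral0.
  by rewrite integral_mode_weight // d_gt0.
rewrite sumEFin /= -mulr_sumr mulrA mulVf ?mul1r //.
by rewrite mulf_neq0 // gt_eqF // pi_gt0.
Qed.

End SteadyState.

(** * Differentiability and bounds for the modal cost *)

Section ModeCost.
Variables (R : realType) (tau : R).
Hypothesis tau_ge0 : 0 <= tau.

(** The derivative of [mode_cost], factored like the matrix product in the sensitivity formula. *)
Definition dmode_cost (l : R) :=
  2^-1 * ((l ^+ 2)^-1 * (tau * l - cos (tau * l)) / (1 - sin (tau * l))).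

Lemma is_derive_mode_cost (l : R) : 0 < l -> tau * l < pi / 2 ->
  is_derive l (1 : R) (mode_cost tau) (dmode_cost l).
Proof.
move=> l0 tl; have tl0 : 0 <= tau * l by rewrite mulr_ge0 // ltW.
have s1 : 1 - sin (tau * l) != 0 by rewrite subr_eq0 gt_eqF // sin_delay_lt1.
have dt : is_derive l (1 : R) (fun x => tau * x) tau.
  apply: (is_derive_eq (derive_mul (is_derive_cst tau l (1 : R)) (is_derive_id l (1 : R)))).
  by rewrite mul0r add0r mulr1.
have dc := @is_derive1_comp _ cos _ l _ _ (is_derive_cos _) dt.
have ds := @is_derive1_comp _ sin _ l _ _ (is_derive_sin _) dt.
have d2 := derive_mul (is_derive_cst (2 : R) l (1 : R)) (is_derive_id l (1 : R)).
have d1 := derive_sub (is_derive_cst (1 : R) l (1 : R)) ds.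
have dd := derive_mul d2 d1.
have D0 : 2 * l * (1 - sin (tau * l)) != 0.
  by rewrite mulf_neq0 // mulf_neq0 // gt_eqF.
have -> : mode_cost tau = (fun x => cos (tau * x) / (2 * x * (1 - sin (tau * x)))).
  by [].
have di := @derive_inv _ (fun x => 2 * x * (1 - sin (tau * x))) l _ D0 dd.
apply: (is_derive_eq (@derive_mul _ (fun x => cos (tau * x)) _ l _ _ dc di)).
rewrite /dmode_cost /=; set c := cos _; set S := sin _ in s1 *.
(* Turns the numerator of the quotient rule into (1 - S) (tau l - c), so one factor 1 - S
   cancels. *)
have cS : c * c = (1 - S) * (1 + S).
  by have := cos2sin2 (tau * l); rewrite -/c -/S expr2 => ->; ring.
transitivity ((- tau * S * l * (1 - S) + tau * l * (c * c) - c * (1 - S)) /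
   (2 * l ^+ 2 * (1 - S) ^+ 2)).
  by field; rewrite s1 gt_eqF.
by rewrite cS; field; rewrite s1 gt_eqF.
Qed.

Lemma mode_cost_bounded (m c x : R) : 0 < m -> 0 <= c < pi / 2 -> m <= x ->
  tau * x <= c -> `|mode_cost tau x| <= (2 * m * (1 - sin c))^-1.
Proof.
move=> m0 /andP[c0 cp] mx txc; have x0 : 0 < x by exact: lt_le_trans mx.
have tx0 : 0 <= tau * x by rewrite mulr_ge0 // ltW.
have sc : sin (tau * x) <= sin c.
  rewrite leNgt ltr_sin -?leNgt // in_itv/=; apply/andP; split.
  - by rewrite (le_trans _ c0) // oppr_le0 divr_ge0 // pi_ge0.
  - exact: ltW.
  - by rewrite (le_trans _ tx0) // oppr_le0 divr_ge0 // pi_ge0.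
  - exact: le_trans txc (ltW cp).
have c1 : 0 < 1 - sin c by rewrite subr_gt0 sin_delay_lt1.
have x1 : 0 < 1 - sin (tau * x) by apply: lt_le_trans c1 _; rewrite lerD2l lerN2.
rewrite normrM normfV (gtr0_norm (x := 2 * x * _)); last by rewrite !mulr_gt0.
rewrite -[X in _ <= X]mul1r ler_pM ?cos_max ?invr_ge0 //; first by rewrite ltW // !mulr_gt0.
rewrite lef_pV2 ?posrE ?mulr_gt0 //.
apply: ler_pM; [by rewrite mulr_ge0 // ltW|exact: ltW|by rewrite ler_pM2l|].
by rewrite lerD2l lerN2.
Qed.

(** A first-order expansion at l that holds on the whole admissible range of x and not only near l,
    since eigenvectors for distant eigenvalues may overlap slightly after the perturbation. The
    price is the quadratic term, whose constant depends on e. *)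
Lemma mode_cost_taylor (m c l e : R) : 0 < m -> 0 <= c < pi / 2 ->
  m <= l -> tau * l <= c -> 0 < e ->
  exists2 K, 0 <= K & forall x, m <= x -> tau * x <= c ->
    `|mode_cost tau x - mode_cost tau l - dmode_cost l * (x - l)|
      <= e * `|x - l| + K * (x - l) ^+ 2.
Proof.
move=> m0 cp ml tlc e0; have l0 : 0 < l by exact: lt_le_trans ml.
have tl : tau * l < pi / 2 by case/andP: cp => _; exact: le_lt_trans.
have [del del0 h] : exists2 del : R, 0 < del & forall x, `|x - l| < del ->
    `|mode_cost tau x - mode_cost tau l - dmode_cost l * (x - l)| <= e * `|x - l|.
  have [dd dE] := is_derive_mode_cost l0 tl.
  have : h^-1 *: (mode_cost tau (h *: 1 + l) - mode_cost tau l) @[h --> 0^'] --> dmode_cost l.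
    by rewrite -dE; exact: dd.
  move=> /cvgrPdist_le /(_ e e0) [del /= del0 hd]; exists del => // x xl.
  have [->|xl0] := eqVneq x l; first by rewrite !subrr mulr0 subrr normr0 mulr0.
  have y0 : x - l != 0 by rewrite subr_eq0.
  have := hd (x - l); rewrite /= sub0r normrN => /(_ xl y0).
  rewrite /GRing.scale /= mulr1 subrK => hx.
  rewrite -[X in `|X|](_ : - (x - l) * (dmode_cost l -
     (x - l)^-1 * (mode_cost tau x - mode_cost tau l)) = _); last by field.
  by rewrite normrM normrN mulrC ler_wpM2r.
pose B := (2 * m * (1 - sin c))^-1.
have B0 : 0 <= B by apply: le_trans (mode_cost_bounded m0 cp ml tlc).
(* Where [|x - l| >= del], boundedness alone gives a bound by [K (x - l)^2]. *)
pose K := (2 * B / del + `|dmode_cost l|) / del.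
have K0 : 0 <= K.
  by rewrite divr_ge0 ?(ltW del0) // addr_ge0 // divr_ge0 ?(ltW del0) // mulr_ge0.
exists K => // x mx txc; have [xl|xl] := ltP `|x - l| del.
  by rewrite (le_trans (h _ xl)) // lerDl mulr_ge0 // sqr_ge0.
apply: (@le_trans _ _ (K * (x - l) ^+ 2)); last first.
  by rewrite lerDr mulr_ge0 // ltW.
apply: (@le_trans _ _ (2 * B + `|dmode_cost l| * `|x - l|)).
  apply: (le_trans (ler_normB _ _)); rewrite normrM lerD2r.
  apply: (le_trans (ler_normB _ _)).
  have := mode_cost_bounded m0 cp ml tlc; have := mode_cost_bounded m0 cp mx txc.
  by rewrite -/B; lra.
rewrite -real_normK ?num_real //.
move: (`|x - l|) xl (`|dmode_cost l|) (normr_ge0 (dmode_cost l)) @K K0 => y yd g g0 K K0.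
have y0 : 0 < y by exact: lt_le_trans yd.
have yd1 : 1 <= y / del by rewrite ler_pdivlMr // mul1r.
have -> : K * y ^+ 2 = 2 * B * (y / del) ^+ 2 + g * y * (y / del).
  by rewrite /K; field; rewrite gt_eqF.
apply: lerD.
  by rewrite ler_peMr ?mulr_ge0 // exprn_ege1.
by rewrite ler_peMr // mulr_ge0 // ltW.
Qed.

End ModeCost.

(** * Laplacians and rank-one perturbations *)

Section Laplacian.
Variables (R : realType) (n : nat).
Implicit Types (adj : rel 'I_n) (w : 'I_n -> 'I_n -> R).

Lemma Evec_dot (a b : 'I_n) (x : 'cV[R]_n) :
  ((Evec R a b)^T *m x) 0 0 = x a 0 - x b 0.
Proof.
rewrite mxE (eq_bigr (fun k => (k == a)%:R * x k 0 - (k == b)%:R * x k 0)); last first.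
  by move=> k _; rewrite !mxE mulrBl.
rewrite sumrB (bigD1 a) //= eqxx mul1r big1 ?addr0; last first.
  by move=> k /negPf ->; rewrite mul0r.
rewrite (bigD1 b) //= eqxx mul1r big1 ?addr0 //.
by move=> k /negPf ->; rewrite mul0r.
Qed.

Lemma Evec_swap (a b : 'I_n) : Evec R b a = - Evec R a b.
Proof. by apply/matrixP => i j; rewrite !mxE opprB. Qed.

Lemma Evec_sqr_swap (a b : 'I_n) :
  Evec R b a *m (Evec R b a)^T = Evec R a b *m (Evec R a b)^T.
Proof. by rewrite Evec_swap linearN /= mulmxN mulNmx opprK. Qed.

Lemma tr_Evec_sqr (a b : 'I_n) :
  (Evec R a b *m (Evec R a b)^T)^T = Evec R a b *m (Evec R a b)^T.
Proof. by rewrite trmx_mul trmxK. Qed.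

Lemma laplacian_sym adj w : (laplacian adj w)^T = laplacian adj w.
Proof.
rewrite /laplacian linear_sum; apply: eq_bigr => i _; rewrite linear_sum.
by apply: eq_bigr => j _; rewrite linearZ /= tr_Evec_sqr.
Qed.

Lemma laplacian_quad adj w (x : 'cV[R]_n) :
  (x^T *m laplacian adj w *m x) 0 0 =
  \sum_(i : 'I_n) \sum_(j : 'I_n | (i < j)%N && adj i j)
    w i j * (x i 0 - x j 0) ^+ 2.
Proof.
rewrite /laplacian mulmx_sumr mulmx_suml summxE; apply: eq_bigr => i _.
rewrite mulmx_sumr mulmx_suml summxE; apply: eq_bigr => j _.
set F := Evec R i j.
have q : (x^T *m (F *m F^T) *m x) 0 0 = (x i 0 - x j 0) ^+ 2.
  have -> : x^T *m (F *m F^T) *m x = (F^T *m x)^T *m (F^T *m x).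
    by rewrite trmx_mul trmxK !mulmxA.
  by rewrite mxE big_ord1 [(_^T) _ _]mxE Evec_dot expr2.
by rewrite -scalemxAr -scalemxAl [LHS]mxE q.
Qed.

Lemma laplacian_const adj w (c : R) : laplacian adj w *m const_mx c = 0 :> 'cV[R]_n.
Proof.
rewrite /laplacian mulmx_suml big1 // => i _; rewrite mulmx_suml big1 // => j _.
rewrite -scalemxAl -mulmxA (_ : _^T *m _ = 0) ?mulmx0 ?scaler0 //.
by apply/matrixP => k l; rewrite !ord1 Evec_dot !mxE subrr.
Qed.

(** The double sum meets each undirected edge once, as a pair i < j. The matrix E E^T does not
    depend on the orientation, so a < b may be assumed, and then exactly one term changes. *)
Lemma laplacian_wupd adj w (a b : 'I_n) (t : R) :
  (forall i j, adj i j = adj j i) -> (forall i, ~~ adj i i) -> adj a b ->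
  laplacian adj (wupd w a b t) =
  laplacian adj w + t *: (Evec R a b *m (Evec R a b)^T).
Proof.
move=> adjC adjI.
wlog lt_ab : a b / (a < b)%N => [H|] adj_ab.
  have [lt_ab|lt_ba|/val_inj ab] := ltngtP a b; first exact: H.
    rewrite -Evec_sqr_swap -H ?(adjC b) //; congr laplacian.
    by apply/funext => i; apply/funext => j; rewrite /wupd orbC.
  by move: adj_ab; rewrite ab (negPf (adjI b)).
pose c i j := if (i == a) && (j == b) then t else 0.
transitivity (laplacian adj w + \sum_(i : 'I_n) \sum_(j : 'I_n | (i < j)%N && adj i j)
    c i j *: (Evec R i j *m (Evec R i j)^T)).
  rewrite /laplacian -big_split; apply: eq_bigr => i _ /=.
  rewrite -big_split; apply: eq_bigr => j /andP[lt_ij _] /=.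
  rewrite -scalerDl; congr (_ *: _); rewrite /wupd /c.
  case: ifP => [/orP[->//|/andP[/eqP ib /eqP ja]]|/negbT].
    by move: lt_ij; rewrite ib ja ltnNge (ltnW lt_ab).
  by rewrite negb_or => /andP[/negPf -> _]; rewrite addr0.
congr (_ + _); rewrite (bigD1 a) //= (bigD1 b) ?lt_ab //= /c !eqxx /=.
rewrite big1 ?addr0; last by move=> j /andP[_ /negPf ->]; rewrite scale0r.
rewrite big1 ?addr0 // => i /negPf ia; apply: big1 => j _.
by rewrite ia scale0r.
Qed.

Section Connected.
Variables (adj : rel 'I_n) (w : 'I_n -> 'I_n -> R).
Hypotheses (wg : weighted_graph adj w) (cg : connected_graph adj).

(** The quadratic form vanishes at x and is a sum of non-negative edge terms, so x agrees at the
    ends of every edge, hence along every path. *)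
Lemma laplacian_kernel (x : 'cV[R]_n) :
  laplacian adj w *m x = 0 -> forall i j, x i 0 = x j 0.
Proof.
case: wg => adjC [adjI [wC w0]] Lx.
have term_ge0 i j : adj i j -> 0 <= w i j * (x i 0 - x j 0) ^+ 2.
  by move=> ij; rewrite mulr_ge0 ?sqr_ge0 // ltW // w0.
have edge (i j : 'I_n) : (i < j)%N -> adj i j -> x i 0 = x j 0.
  move=> lt_ij adj_ij; have := laplacian_quad adj w x.
  rewrite -mulmxA Lx mulmx0 mxE => /esym/eqP; rewrite psumr_eq0; last first.
    by move=> k _; apply: sumr_ge0 => l /andP[_]; exact: term_ge0.
  move=> /allP/(_ i (mem_index_enum _)); rewrite psumr_eq0; last first.
    by move=> l /andP[_]; exact: term_ge0.
  move=> /allP/(_ j (mem_index_enum _)); rewrite lt_ij adj_ij /= mulf_eq0.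
  by rewrite gt_eqF ?w0 //= sqrf_eq0 subr_eq0 => /eqP.
have step (i j : 'I_n) : adj i j -> x i 0 = x j 0.
  move=> ij; have [lt_ij|lt_ji|/val_inj -> //] := ltngtP i j; first exact: edge.
  by apply/esym/edge; rewrite // adjC.
move=> i j; have /connectP[p] := cg i j.
elim: p i => [|k p IH] i /= => [_ -> //|/andP[ik kp] jl].
by rewrite (step _ _ ik); exact: IH.
Qed.

Variables (U : 'M[R]_n) (d : 'I_n -> R).
Hypotheses (UU : U *m U^T = 1%:M) (LE : laplacian adj w = spmx U d).

Lemma laplacian_eig_ge0 k : 0 <= d k.
Proof.
have ckk : (col k U)^T *m col k U = 1%:M.
  have -> : (col k U)^T *m col k U = ((U^T *m U) k k)%:M.
    rewrite [LHS]mx11_scalar; congr (_%:M); rewrite !mxE; apply: eq_bigr => l _.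
    by rewrite !mxE.
  by rewrite (mulmx1C UU) mxE eqxx.
have -> : d k = ((col k U)^T *m laplacian adj w *m col k U) 0 0.
  by rewrite LE -mulmxA spmx_col // -scalemxAr ckk !mxE eqxx mulr1.
rewrite laplacian_quad; apply: sumr_ge0 => i _; apply: sumr_ge0 => j /andP[_ ij].
by case: wg => _ [_ [_ w0]]; rewrite mulr_ge0 ?sqr_ge0 // ltW // w0.
Qed.

(** [Mn] is the orthogonal projector onto the range of the Laplacian. An eigenvector for 0 is
    constant by connectedness and is killed by [Mn]; any other is orthogonal to the constants and is
    fixed. *)
Lemma Mn_spmx : Mn R n = spmx U (fun k => (d k != 0)%:R).
Proof.
case: (posnP n) => [n0|n_gt0].
  by apply/matrixP => i; exfalso; have := ltn_ord i; rewrite [X in (_ < X)%N]n0.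
have nn0 : n%:R != 0 :> R by rewrite pnatr_eq0 -lt0n.
have MU : Mn R n *m U = U *m diag_mx (\row_k (d k != 0)%:R).
  apply/matrixP => i k; rewrite mul_mx_diag mulmxBl mul1mx -scalemxAl !mxE.
  rewrite (eq_bigr (fun j => U j k)); last by move=> j _; rewrite mxE mul1r.
  have [dk|dk] := eqVneq (d k) 0.
    have Lk : laplacian adj w *m col k U = 0 by rewrite LE spmx_col // dk scale0r.
    rewrite (eq_bigr (fun=> U i k)); last first.
      by move=> j _; have := laplacian_kernel Lk j i; rewrite !mxE.
    by rewrite sumr_const card_ord -[U i k *+ n]mulr_natl mulKf // subrr mulr0.
  (* d k times this sum is the all-ones row applied to L u_k, which is zero because L is symmetric
     and kills constants. *)
  rewrite (_ : \sum_j U j k = 0) ?mulr0 ?subr0 ?mulr1 //.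
  apply: (mulfI dk); rewrite mulr0.
  have := congr1 (fun x : 'cV[R]_n => (const_mx 1 : 'rV[R]_n) *m x) (spmx_col UU d k).
  rewrite -LE mulmxA.
  have -> : (const_mx 1 : 'rV[R]_n) *m laplacian adj w = 0.
    by rewrite -[LHS]trmxK trmx_mul laplacian_sym trmx_const laplacian_const trmx0.
  rewrite mul0mx => /matrixP/(_ 0 0); rewrite -scalemxAr !mxE => h; rewrite [RHS]h; congr (_ * _).
  by apply: eq_bigr => j _; rewrite !mxE mul1r.
by rewrite /spmx -MU -mulmxA UU mulmx1.
Qed.

Lemma le_lambda_max k : d k <= lambda_max (laplacian adj w).
Proof.
rewrite /lambda_max; case: xgetP => [l _ [_ lmax]|nomax].
  by apply: lmax; rewrite LE; exact: eigenvalue_spmx.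
(* The default value of [xget] cannot occur: the largest [d k] is a largest eigenvalue. *)
have [l _ lmax] := @arg_maxP _ _ 'I_n k predT d isT.
exfalso; apply: (nomax (d l)); rewrite /= LE; split; first exact: eigenvalue_spmx.
by move=> mu /(spmx_eigenvalue UU)[j ->]; exact: lmax.
Qed.

End Connected.
End Laplacian.

Section RankOnePerturbation.
Variables (R : realType) (n : nat) (U V : 'M[R]_n) (d m : 'I_n -> R).
Variables (E : 'cV[R]_n) (t : R).
Hypotheses (UU : U *m U^T = 1%:M) (VV : V *m V^T = 1%:M).
Hypothesis (pert : spmx V m = spmx U d + t *: (E *m E^T)).

(** Overlaps of the two eigenbases, followed by the coordinates of [E] in each of them. *)
Let c k l := (U^T *m V) k l.
Let e k := (U^T *m E) k 0.
Let e' l := (V^T *m E) l 0.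
Let N : R := (E^T *m E) 0 0.

(** Entry (k, l) of U^T (L + t E E^T) V, with the perturbed matrix diagonalised once as a whole and
    once only in its unperturbed part. *)
Lemma overlap_eig k l : c k l * (m l - d k) = t * (e k * e' l).
Proof.
have h : U^T *m V *m diag_mx (\row_l m l) =
    diag_mx (\row_k d k) *m (U^T *m V) + t *: ((U^T *m E) *m (V^T *m E)^T).
  transitivity (U^T *m spmx V m *m V).
    by rewrite /spmx !mulmxA -(mulmxA _ V^T V) (mulmx1C VV) mulmx1.
  rewrite pert mulmxDr mulmxDl; congr (_ + _).
    by rewrite /spmx !mulmxA (mulmx1C UU) mul1mx.
  by rewrite -scalemxAr -scalemxAl trmx_mul trmxK !mulmxA.
have hl : (U^T *m V *m diag_mx (\row_l m l)) k l = c k l * m l.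
  by rewrite mul_mx_diag [LHS]mxE [(\row__ _) _ _]mxE.
have hr : (diag_mx (\row_k d k) *m (U^T *m V)) k l = d k * c k l.
  by rewrite mul_diag_mx [LHS]mxE [(\row__ _) _ _]mxE.
have he : ((U^T *m E) *m (V^T *m E)^T) k l = e k * e' l.
  by rewrite [LHS]mxE big_ord1 [(_^T) _ _]mxE.
have hs : (diag_mx (\row_k d k) *m (U^T *m V)
    + t *: ((U^T *m E) *m (V^T *m E)^T)) k l = d k * c k l + t * (e k * e' l).
  by rewrite mxE hr [X in _ + X]mxE he.
by rewrite mulrBr -hl h hs [c k l * d k]mulrC addrAC subrr add0r.
Qed.

Lemma overlap_rowsum k : \sum_l c k l ^+ 2 = 1.
Proof.
have : (U^T *m V) *m (U^T *m V)^T = 1%:M.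
  by rewrite trmx_mul trmxK mulmxA -(mulmxA U^T) VV mulmx1 (mulmx1C UU).
move=> h; transitivity ((1%:M : 'M[R]_n) k k); last by rewrite mxE eqxx.
rewrite -h [RHS]mxE; apply: eq_bigr => l _.
by rewrite [(_^T) _ _]mxE -/(c k l) expr2.
Qed.

Lemma overlap_colsum l : \sum_k c k l ^+ 2 = 1.
Proof.
have : (U^T *m V)^T *m (U^T *m V) = 1%:M.
  by rewrite trmx_mul trmxK mulmxA -(mulmxA V^T) UU mulmx1 (mulmx1C VV).
move=> h; transitivity ((1%:M : 'M[R]_n) l l); last by rewrite mxE eqxx.
rewrite -h [RHS]mxE; apply: eq_bigr => k _.
by rewrite [(_^T) _ _]mxE -/(c k l) expr2.
Qed.

Lemma overlap_coord k : \sum_l c k l * e' l = e k.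
Proof.
have : (U^T *m V) *m (V^T *m E) = U^T *m E by rewrite mulmxA -(mulmxA U^T) VV mulmx1.
by move/matrixP/(_ k 0); rewrite mxE.
Qed.

Lemma norm_overlap_le1 k l : `|c k l| <= 1.
Proof.
rewrite -(expr_le1 (n := 2)) // real_normK ?num_real // -(overlap_rowsum k).
by rewrite (bigD1 l) //= lerDl sumr_ge0 // => j _; exact: sqr_ge0.
Qed.

Lemma sqr_coord_le k l : (e k) ^+ 2 <= N /\ (e' l) ^+ 2 <= N.
Proof.
have aux (W : 'M[R]_n) : W *m W^T = 1%:M -> forall j, (W^T *m E) j 0 ^+ 2 <= N.
  move=> WW j; have -> : N = \sum_i (W^T *m E) i 0 ^+ 2.
    rewrite /N -[E^T]mulmx1 -WW mulmxA -mulmxA -{1}(trmxK W) -trmx_mul mxE.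
    by apply: eq_bigr => i _; rewrite [in LHS]mxE expr2.
  by rewrite (bigD1 j) //= lerDl sumr_ge0 // => i _; exact: sqr_ge0.
by split; exact: aux.
Qed.

Lemma dot_self_ge0 : 0 <= N.
Proof. by rewrite /N mxE sumr_ge0 // => i _; rewrite mxE -expr2 sqr_ge0. Qed.

Lemma norm_coord_mul_le k l : `|e k * e' l| <= N.
Proof.
have [h1 h2] := sqr_coord_le k l.
rewrite -ler_sqr ?nnegrE ?normr_ge0 ?dot_self_ge0 // real_normK ?num_real // exprMn expr2.
by apply: ler_pM => //; rewrite sqr_ge0.
Qed.

(** The Rayleigh quotient at v_l: a convex combination of the [d k], by [overlap_colsum], plus the
    rank-one contribution. This is what localises the perturbed spectrum. *)
Lemma perturbed_eigE l : m l = \sum_k d k * c k l ^+ 2 + t * e' l ^+ 2.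
Proof.
have h : \sum_k c k l * (c k l * (m l - d k)) = t * e' l ^+ 2.
  rewrite (eq_bigr (fun k => t * e' l * (c k l * e k))); last first.
    by move=> k _; rewrite overlap_eig; ring.
  rewrite -mulr_sumr expr2 mulrA; congr (_ * _).
  have : (U^T *m V)^T *m (U^T *m E) = V^T *m E.
    by rewrite trmx_mul trmxK mulmxA -(mulmxA V^T) UU mulmx1.
  move/matrixP/(_ l 0); rewrite -/(e' l) => <-; rewrite [RHS]mxE.
  by apply: eq_bigr => k _; rewrite [(_^T) _ _]mxE.
rewrite -h -big_split /= -[LHS]mul1r -(overlap_colsum l) mulr_suml.
by apply: eq_bigr => k _; ring.
Qed.

(** The squared overlaps form a doubly stochastic matrix, so all three sums can be rewritten over
    pairs of modes, the last one with the help of [overlap_eig]. The expansion of f is required only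
    for overlapping pairs, which lets the consensus mode be treated apart. *)
Lemma trace_perturbation (f : R -> R) (g : 'I_n -> R) (eps K : R) :
  0 <= eps -> 0 <= K ->
  (forall k l, c k l != 0 -> `|f (m l) - f (d k) - g k * (m l - d k)|
     <= eps * `|m l - d k| + K * (m l - d k) ^+ 2) ->
  `|\sum_l f (m l) - \sum_k f (d k) - t * \sum_k g k * e k ^+ 2|
    <= eps * (n%:R ^+ 2 * N) * `|t| + K * (n%:R ^+ 2 * N ^+ 2) * t ^+ 2.
Proof.
move=> eps0 K0 h.
have -> : \sum_l f (m l) - \sum_k f (d k) - t * \sum_k g k * e k ^+ 2 =
    \sum_k \sum_l c k l ^+ 2 * (f (m l) - f (d k) - g k * (m l - d k)).
  have -> : \sum_l f (m l) = \sum_k \sum_l c k l ^+ 2 * f (m l).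
    rewrite exchange_big; apply: eq_bigr => l _ /=.
    by rewrite -mulr_suml overlap_colsum mul1r.
  have -> : \sum_k f (d k) = \sum_k \sum_l c k l ^+ 2 * f (d k).
    by apply: eq_bigr => k _; rewrite -mulr_suml overlap_rowsum mul1r.
  have -> : t * \sum_k g k * e k ^+ 2 =
      \sum_k \sum_l c k l ^+ 2 * (g k * (m l - d k)).
    rewrite mulr_sumr; apply: eq_bigr => k _.
    rewrite (eq_bigr (fun l => t * g k * e k * (c k l * e' l))); last first.
      move=> l _; transitivity (g k * c k l * (c k l * (m l - d k))); first by ring.
      by rewrite overlap_eig; ring.
    by rewrite -mulr_sumr overlap_coord; ring.
  rewrite -!sumrB; apply: eq_bigr => k _; rewrite -!sumrB; apply: eq_bigr => l _.
  by ring.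
apply: (@le_trans _ _ (\sum_(k < n) \sum_(l < n)
    (eps * N * `|t| + K * N ^+ 2 * t ^+ 2))); last first.
  rewrite !sumr_const !card_ord -mulrnA -[_ *+ _]mulr_natl natrM.
  by rewrite le_eqVlt; apply/orP; left; apply/eqP; ring.
apply: (le_trans (ler_norm_sum _ _ _)); apply: ler_sum => k _.
apply: (le_trans (ler_norm_sum _ _ _)); apply: ler_sum => l _.
have [->|c0] := eqVneq (c k l) 0.
  have t1 : 0 <= eps * N * `|t| by rewrite !mulr_ge0 ?dot_self_ge0.
  have t2 : 0 <= K * N ^+ 2 * t ^+ 2.
    by apply: mulr_ge0; rewrite ?sqr_ge0 // mulr_ge0 ?sqr_ge0.
  by rewrite expr0n mul0r normr0 addr_ge0.
(* |m l - d k| need not be small, but its product with |c k l| is. The linear error term spends one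
   factor of (c k l)^2 on this and bounds the other by 1; the quadratic term spends both. *)
have ov : `|c k l| * `|m l - d k| <= `|t| * N.
  by rewrite -normrM overlap_eig normrM ler_wpM2l // norm_coord_mul_le.
rewrite normrM normrX.
apply: (@le_trans _ _ (`|c k l| ^+ 2 * (eps * `|m l - d k| + K * (m l - d k) ^+ 2))).
  by rewrite ler_wpM2l ?sqr_ge0 // h.
rewrite mulrDr; apply: lerD.
  have -> : `|c k l| ^+ 2 * (eps * `|m l - d k|) =
     eps * (`|c k l| * (`|c k l| * `|m l - d k|)) by ring.
  rewrite -mulrA ler_wpM2l // [N * _]mulrC -[X in _ <= X]mul1r.
  by apply: ler_pM; rewrite ?mulr_ge0 // norm_overlap_le1.
rewrite -(real_normK (num_real (m l - d k))) -(real_normK (num_real t)).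
have -> : `|c k l| ^+ 2 * (K * `|m l - d k| ^+ 2) =
   K * (`|c k l| * `|m l - d k|) ^+ 2 by ring.
rewrite -mulrA ler_wpM2l // -exprMn lerXn2r ?nnegrE ?mulr_ge0 ?dot_self_ge0 //.
by rewrite [N * _]mulrC.
Qed.

End RankOnePerturbation.

(** K may depend on eps: half of eps is kept for the linear term, and the other half absorbs K |t|
    once t is small enough. *)
Lemma is_derive0_of_bound (R : realType) (F : R -> R) (v : R) :
  (forall eps, 0 < eps -> exists K, exists2 del, 0 < del & forall t, `|t| < del ->
    `|F t - F 0 - t * v| <= eps * `|t| + K * t ^+ 2) ->
  is_derive (0 : R) (1 : R) F v.
Proof.
move=> h.
have cv : h^-1 *: (F (h *: 1 + 0) - F 0) @[h --> 0^'] --> v.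
  apply/cvgrPdist_le => eps eps0.
  have e2 : 0 < eps / 2 by rewrite divr_gt0.
  have [K [del del0 hK]] := h _ e2.
  have K1 : 0 < `|K| + 1 by rewrite ltr_wpDl.
  near=> t.
  have t0 : t != 0 by near: t; exact: nbhs_dnbhs_neq.
  have tdel : `|t| < del.
    by near: t; apply: dnbhs0_lt.
  have tK : `|t| < eps / 2 / (`|K| + 1).
    by near: t; apply: dnbhs0_lt; rewrite divr_gt0.
  have n0 : 0 < `|t| by rewrite normr_gt0.
  rewrite /GRing.scale /= mulr1 addr0.
  have -> : v - t^-1 * (F t - F 0) = - t^-1 * (F t - F 0 - t * v) by field.
  rewrite normrM normrN normfV mulrC ler_pdivrMr //.
  apply: (le_trans (hK _ tdel)).
  have -> : eps * `|t| = eps / 2 * `|t| + eps / 2 * `|t| by field.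
  rewrite lerD2l -real_normK ?num_real // expr2 mulrA ler_wpM2r //.
  apply: (@le_trans _ _ ((`|K| + 1) * `|t|)).
    by rewrite ler_wpM2r // (le_trans (ler_norm K)) // lerDl.
  by rewrite mulrC -ler_pdivlMr // ltW.
apply: DeriveDef; first by apply/cvg_ex; exists v.
by apply/cvg_lim => //; exact: Rhausdorff.
Unshelve. all: by end_near. Qed.

Lemma finite_pos_lb (R : realType) (n : nat) (d : 'I_n -> R) :
  exists2 m : R, 0 < m & forall k, 0 < d k -> m <= d k.
Proof.
exists (\big[Num.min/1]_(k | 0 < d k) d k).
  by elim/big_ind: _ => // x y x0 y0; rewrite lt_min x0.
by move=> k dk; rewrite (bigD1 k) //= ge_min lexx.
Qed.

(** * The sensitivity of a link *)

Section Sensitivity.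
Variables (R : realType) (n : nat) (adj : rel 'I_n).
Variables (w : 'I_n -> 'I_n -> R) (tau : R) (a b : 'I_n).
Hypotheses (wg : weighted_graph adj w) (cg : connected_graph adj).
Hypotheses (tau_ge0 : 0 <= tau).
Hypothesis tl_lt : tau * lambda_max (laplacian adj w) < pi / 2.
Hypothesis adj_ab : adj a b.

Let E := Evec R a b.
Let N : R := (E^T *m E) 0 0.

Lemma weighted_graph_wupd t : `|t| < w a b -> weighted_graph adj (wupd w a b t).
Proof.
case: wg => adjC [adjI [wC w0]] tw; split=> //; split=> //; split.
  move=> i j; rewrite /wupd wC.
  by rewrite [(j == a) && _]andbC [(j == b) && _]andbC orbC.
move=> i j ij; rewrite /wupd; case: ifP => [h|_]; last exact: w0.
have -> : w i j = w a b.
  by case/orP: h => /andP[/eqP -> /eqP ->]; rewrite // wC.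
by move: tw; rewrite ltr_norml => /andP[tw _]; rewrite -ltrBlDl sub0r.
Qed.

(** The modal sums at t and at 0 are compared by [trace_perturbation], with the expansion of
    [mode_cost_taylor] at each positive eigenvalue. First the perturbed spectrum is confined to a
    region that is uniform in small t. *)
Lemma sensitivity (U : 'M[R]_n) (d : 'I_n -> R) :
  U *m U^T = 1%:M -> laplacian adj w = spmx U d ->
  is_derive (0 : R) (1 : R) (fun t => rho_ss (laplacian adj (wupd w a b t)) tau)
    (\sum_k dmode_cost tau (d k) * ((U^T *m E) k 0) ^+ 2).
Proof.
move=> UU LE.
have [adjC [adjI [wC w0]]] := wg.
have d0 := laplacian_eig_ge0 wg UU LE.
have ME := Mn_spmx wg cg UU LE.
pose lmax := lambda_max (laplacian adj w).
have dmax k : d k <= lmax := le_lambda_max UU LE k.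
have [m0 m0_gt0 m0P] := finite_pos_lb d.
have [p hp] : {p : R | p = pi / 2} by exists (pi / 2).
have tlp : tau * lmax < p by rewrite hp.
have tl0 : 0 <= tau * lmax by rewrite mulr_ge0 // (le_trans (d0 a)).
(* Midway between tau lmax and pi / 2. With [m], half of a lower bound for the positive eigenvalues,
   it delimits where the nonzero perturbed eigenvalues will lie. *)
pose c := (tau * lmax + p) / 2.
have cp : 0 <= c < pi / 2 by rewrite -hp /c; apply/andP; split; lra.
have N0 : 0 <= N by exact: dot_self_ge0.
pose m := m0 / 2.
have m_gt0 : 0 < m by rewrite divr_gt0.
(* In turn: the perturbed weight stays positive, nonzero eigenvalues stay above [m], and tau times
   any eigenvalue stays below [c], given shifts of at most |t| N. *)
pose del := Num.min (w a b) (Num.min (m0 / 2 / (N + 1)) ((p - tau * lmax) / 2 / (tau * N + 1))).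
have N1 : 0 < N + 1 by rewrite ltr_wpDl.
have tN1 : 0 < tau * N + 1 by rewrite ltr_wpDl // mulr_ge0.
have del0 : 0 < del.
  by rewrite /del !lt_min w0 //= !divr_gt0 // subr_gt0.
have F0 : rho_ss (laplacian adj (wupd w a b 0)) tau = \sum_k mode_cost tau (d k).
  rewrite laplacian_wupd // scale0r addr0 LE; apply: rho_ss_spmx => // k.
  by apply: le_lt_trans tl_lt; rewrite ler_wpM2l.
apply: is_derive0_of_bound => eps eps0.
(* Compensates the factor n^2 N in front of the linear error term. *)
pose eta := eps / (n%:R ^+ 2 * N + 1).
have nN1 : 0 < n%:R ^+ 2 * N + 1 by rewrite ltr_wpDl // mulr_ge0 // sqr_ge0.
have eta0 : 0 < eta by rewrite divr_gt0.
have /choice[Kf KfP] : forall k, exists K : R, 0 <= K /\ (0 < d k -> forall x,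
    m <= x -> tau * x <= c ->
    `|mode_cost tau x - mode_cost tau (d k) - dmode_cost tau (d k) * (x - d k)|
      <= eta * `|x - d k| + K * (x - d k) ^+ 2).
  move=> k; have [dk|dk] := ltP 0 (d k); last by exists 0; split=> // /(le_lt_trans dk); rewrite ltxx.
  have mdk : m <= d k by rewrite (le_trans _ (m0P _ dk)) // /m; lra.
  have tdk : tau * d k <= c.
    have : tau * d k <= tau * lmax by rewrite ler_wpM2l.
    by rewrite /c; lra.
  by have [K K0 KP] := mode_cost_taylor tau_ge0 m_gt0 cp mdk tdk eta0; exists K.
pose K := \sum_k Kf k.
have K0 : 0 <= K by apply: sumr_ge0 => k _; have [] := KfP k.
have KfK k : Kf k <= K.
  by rewrite /K (bigD1 k) //= lerDl sumr_ge0 // => j _; have [] := KfP j.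
exists (K * (n%:R ^+ 2 * N ^+ 2)); exists del => // t tdel.
have /andP[tw /andP[tm tc]] : (`|t| < w a b) && ((`|t| < m0 / 2 / (N + 1)) &&
    (`|t| < (p - tau * lmax) / 2 / (tau * N + 1))) by move: tdel; rewrite /del !lt_min.
have wgt := weighted_graph_wupd tw.
have pertL := laplacian_wupd w t adjC adjI adj_ab.
have [V [mr [VV VE]]] := spectral_theorem (laplacian_sym adj (wupd w a b t)).
pose mm k := mr 0 k.
have LtE : laplacian adj (wupd w a b t) = spmx V mm.
  by rewrite VE /spmx (_ : \row_k mm k = mr) //; apply/rowP => k; rewrite mxE.
have mm0 := laplacian_eig_ge0 wgt VV LtE.
have MEt := Mn_spmx wgt cg VV LtE.
have pert : spmx V mm = spmx U d + t *: (E *m E^T) by rewrite -LtE -LE.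
(* [Mn] is the same projector for both Laplacians, so U^T Mn V computed in either basis shows that
   zero modes overlap only with zero modes. *)
have ortho k l : (U^T *m V) k l != 0 -> (d k != 0) = (mm l != 0).
  have h : U^T *m Mn R n *m V = U^T *m Mn R n *m V by [].
  move: h; rewrite {1}ME MEt /spmx !mulmxA (mulmx1C UU) mul1mx.
  rewrite -(mulmxA _ V^T V) (mulmx1C VV) mulmx1 -mulmxA.
  move=> /matrixP/(_ k l); rewrite mul_diag_mx mul_mx_diag [LHS]mxE [RHS]mxE.
  rewrite ![(\row__ _) _ _]mxE [LHS]mulrC => hh c0; have /eqP := mulfI c0 hh.
  by rewrite eqr_nat; case: (d k != 0); case: (mm l != 0).
have mE l := perturbed_eigE UU VV pert l.
have e2 l : t * ((V^T *m E) l 0) ^+ 2 <= `|t| * N /\ - (`|t| * N) <= t * ((V^T *m E) l 0) ^+ 2.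
  have [_ h] := sqr_coord_le E UU VV a l; have e0 := sqr_ge0 ((V^T *m E) l 0).
  have : `|t * ((V^T *m E) l 0) ^+ 2| <= `|t| * N.
    by rewrite normrM (ger0_norm e0) ler_wpM2l.
  by rewrite ler_norml => /andP[].
have mm_ub l : tau * mm l <= c.
  have : mm l <= lmax + `|t| * N.
    rewrite mE lerD // ?(e2 l).1 // -[lmax]mulr1 -(overlap_colsum UU VV l) mulr_sumr.
    by apply: ler_sum => k _; rewrite ler_wpM2r ?sqr_ge0.
  move=> h; have : tau * mm l <= tau * (lmax + `|t| * N) by rewrite ler_wpM2l.
  move: tc; rewrite ltr_pdivlMr // /c => tc.
  have := normr_ge0 t; nra.
(* By [ortho], the convex combination for a nonzero [mm l] involves only positive [d k], all at
   least [m0]. *)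
have mm_lb l : mm l != 0 -> m <= mm l.
  move=> ml0; rewrite mE.
  have : m0 <= \sum_k d k * (U^T *m V) k l ^+ 2.
    rewrite -[m0]mulr1 -(overlap_colsum UU VV l) mulr_sumr; apply: ler_sum => k _.
    have [->|c0] := eqVneq ((U^T *m V) k l) 0; first by rewrite expr0n !mulr0.
    rewrite ler_wpM2r ?sqr_ge0 // m0P // lt_neqAle eq_sym d0 andbT.
    by rewrite (ortho _ _ c0).
  have [_ h] := e2 l; move: tm; rewrite ltr_pdivlMr // /m => tm.
  have := normr_ge0 t; nra.
have Ft : rho_ss (laplacian adj (wupd w a b t)) tau = \sum_l mode_cost tau (mm l).
  rewrite LtE; apply: rho_ss_spmx => // l.
  by apply: le_lt_trans (mm_ub l) _; case/andP: cp.
rewrite Ft F0.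
have := @trace_perturbation _ _ U V d mm E t UU VV pert (mode_cost tau)
  (fun k => dmode_cost tau (d k)) eta K (ltW eta0) K0.
move=> /(_ _)/le_trans; apply; last first.
  rewrite lerD2r ler_wpM2r // /eta -mulrAC ler_pdivrMr //.
  by rewrite ler_wpM2l ?(ltW eps0) // lerDl.
(* For the consensus mode both eigenvalues are 0 and both sides of the estimate vanish, although
   [mode_cost] is not differentiable there. *)
move=> k l c0; have [dk|dk] := eqVneq (d k) 0.
  have : mm l == 0 by rewrite -[_ == _]negbK -(ortho _ _ c0) dk eqxx.
  by move=> /eqP ->; rewrite dk !(subrr, mulr0, normr0, expr0n, addr0).
have ml : mm l != 0 by rewrite -(ortho _ _ c0).
have dk0 : 0 < d k by rewrite lt_neqAle eq_sym dk d0.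
have [Kf0 Kfk] := KfP k; apply: (le_trans (Kfk dk0 _ (mm_lb _ ml) (mm_ub l))).
by rewrite lerD2l ler_wpM2r ?sqr_ge0.
Qed.

End Sensitivity.

Theorem theorem4 (R : realType) (n : nat) (adj : rel 'I_n)
    (w : 'I_n -> 'I_n -> R) (tau : R) (a b : 'I_n) :
  weighted_graph adj w -> connected_graph adj ->
  0 <= tau -> tau * lambda_max (laplacian adj w) < pi / 2 ->
  adj a b ->
  let L := laplacian adj w in
  is_derive (0 : R) (1 : R)
    (fun t : R => rho_ss (laplacian adj (wupd w a b t)) tau)
    (2^-1 * ((Evec R a b)^T *m mpinv (L *m L)
              *m (tau *: L - cosmx (tau *: L))
              *m mpinv (Mn R n - sinmx (tau *: L)) *m Evec R a b) 0 0).
Proof.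
move=> wg cg tau0 tl adj_ab L.
have [U [dr [UU LE']]] := spectral_theorem (laplacian_sym adj w).
pose d k := dr 0 k.
have LE : laplacian adj w = spmx U d.
  by rewrite LE' /spmx (_ : \row_k d k = dr) //; apply/rowP => k; rewrite mxE.
apply: (is_derive_eq (sensitivity wg cg tau0 tl adj_ab UU LE)).
rewrite (Mn_spmx wg cg UU LE) /L LE spmxM // mpinv_spmx // spmxZ cosmx_spmx //.
rewrite sinmx_spmx // !spmxB mpinv_spmx // -(mulmxA _ (spmx _ _) (spmx _ _)) spmxM //.
rewrite -(mulmxA _ (spmx _ _) (spmx _ _)) spmxM // spmx_quad mulr_sumr.
apply: eq_bigr => k _; rewrite [RHS]mulrA; congr (_ * _).
congr (_ * _).
(* On the consensus mode the eigenvalue of [Mn] is 0, unlike the 1 in [dmode_cost], but the factor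
   (0^2)^-1 = 0 annihilates both sides. *)
rewrite -expr2; have [->|_] := eqVneq (d k) 0; first by rewrite expr0n /= invr0 !mul0r.
by rewrite mulrA.
Qed.
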